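(* Let $P=\{1_P,\dots,L_P\}$ be a chain of $L$ qubits and let $C$ be a (nonzero) Clifford monitored dynamics on $P$, i.e. a product $C=C_tC_{t-1}\cdots C_1$ in which every factor is either a two-qubit Clifford unitary or a single-qubit projector $\frac{1\pm Z_i}{2}$ onto a fixed outcome of a Pauli-$Z$ measurement. Define the input and output code projectors $P_{\mathrm{in}}=C^\dagger C$ and $P_{\mathrm{out}}=CC^\dagger$. Let $R=\{1_R,\dots,L_R\}$ be a reference copy of $P$ and let $$|\phi\rangle\propto\sum_{\mathbf{s}\in\{0,1\}^L}\big(C|\mathbf{s}\rangle\big)_P\otimes|\mathbf{s}\rangle_R$$ (normalized). For subsets $A,B\subseteq\{1,\dots,L\}$ of sites, write $A_R\subseteq R$ and $B_P\subseteq P$ for the corresponding qubits, and let $I_{A_R:B_P}=S_{A_R}+S_{B_P}-S_{A_R\cup B_P}$ be the mutual information of $|\phi\rangle$ (von Neumann entropies in base $2$). Then $I_{A_R:B_P}$ equals the number of independent and inequivalent Pauli logical operators of the input code that are supported on $A$ and can be transferred by $C$ to some logical operator of the output code supported on $B$.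
   Context: All nonzero singular values of such a $C$ equal $1$, so $P_{\mathrm{in}}$ and $P_{\mathrm{out}}$ are projectors onto stabilizer code subspaces $\mathcal{H}_{\mathrm{in}}$ and $\mathcal{H}_{\mathrm{out}}$. A Pauli operator is a tensor product of single-qubit operators $I,X,Y,Z$ (up to a phase). A (Pauli) logical operator of a code with projector $\Pi$ is a Pauli operator $O$ that commutes with $\Pi$; two logical operators $O,O'$ are equivalent if they act identically on the code space ($O\Pi=O'\Pi$), and a logical operator is trivial if it acts on the code space as a multiple of the identity. A logical operator $O$ of the input code is transferred by $C$ to a logical operator $\tilde O$ of the output code if $CO=\tilde{O}C$. ''Supported on $A$'' means acting as the identity outside $A$. ''Independent and inequivalent'' means the operators are counted as independent generators modulo equivalence: no nontrivial product of them is a trivial logical operator. *)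

(* Defs.v *)
From HB Require Import structures.
From mathcomp Require Import all_boot all_order all_algebra.
From mathcomp Require Import reals exp.
From mathcomp Require Import complex.
Set Implicit Arguments. Unset Strict Implicit. Unset Printing Implicit Defensive.
Import Order.TTheory GRing.Theory Num.Theory.
Local Open Scope ring_scope.

Section QuantumClifford.
Variable R : realType.
Local Notation C := R[i].

(** Computational basis of n qubits: |x>, x : 'I_(2^n); qubit q of |x> is
    the q-th binary digit of x. *)
Definition qbit (x q : nat) : bool := odd (x %/ 2 ^ q).

Definition adj n (M : 'M[C]_n) : 'M[C]_n := \matrix_(i, j) conjc (M j i).

Definition unitary n (M : 'M[C]_n) : Prop := M *m adj M = 1%:M.

Inductive pauli1 := PI | PX | PY | PZ.

Definition pauli1_mx (p : pauli1) (a b : bool) : C :=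
  match p with
  | PI => if a == b then 1 else 0
  | PX => if a == b then 0 else 1
  | PY => if a == b then 0 else if a then 'i%C else - 'i%C
  | PZ => if a == b then (if a then -1 else 1) else 0
  end.

(** Tensor product  c * (p_0 (x) p_1 (x) ... (x) p_{n-1}). *)
Definition pauli_mx n (c : C) (p : 'I_n -> pauli1) : 'M[C]_(2 ^ n) :=
  \matrix_(x, y) (c * \prod_(k < n) pauli1_mx (p k) (qbit x k) (qbit y k)).

Definition is_pauli n (M : 'M[C]_(2 ^ n)) : Prop :=
  exists (c : C) (p : 'I_n -> pauli1), c ^+ 4 = 1 /\ M = pauli_mx c p.

Definition pauli_on n (A : {set 'I_n}) (M : 'M[C]_(2 ^ n)) : Prop :=
  exists (c : C) (p : 'I_n -> pauli1),
    [/\ c ^+ 4 = 1, (forall k, k \notin A -> p k = PI) & M = pauli_mx c p].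

Definition clifford2 (U : 'M[C]_4) : Prop :=
  unitary U /\
  forall P : 'M[C]_(2 ^ 2), is_pauli P -> is_pauli (U *m P *m adj U : 'M[C]_(2 ^ 2)).

Inductive gate (L : nat) :=
  | Gate2 of 'I_L & 'I_L & 'M[C]_4
  | Meas of 'I_L & bool.             (* projector (1 + (-1)^o Z_k)/2 *)

Definition valid_gate L (g : gate L) : Prop :=
  match g with
  | Gate2 a b U => a != b /\ clifford2 U
  | Meas _ _ => True
  end.

Definition valid_gates L (gs : seq (gate L)) : Prop :=
  foldr (fun g P => valid_gate g /\ P) True gs.

Definition loc2 (x a b : nat) : 'I_4 := inord (qbit x a + 2 * qbit x b).

Definition gate2_mx L (a b : 'I_L) (U : 'M[C]_4) : 'M[C]_(2 ^ L) :=
  \matrix_(x, y)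
    (if [forall k : 'I_L, ((k != a) && (k != b)) ==> (qbit x k == qbit y k)]
     then U (loc2 x a b) (loc2 y a b) else 0).

Definition meas_mx L (k : 'I_L) (o : bool) : 'M[C]_(2 ^ L) :=
  \matrix_(x, y) (if (x == y) && (qbit x k == o) then 1 else 0).

Definition gate_mx L (g : gate L) : 'M[C]_(2 ^ L) :=
  match g with
  | Gate2 a b U => gate2_mx a b U
  | Meas k o => meas_mx k o
  end.

Definition dynamics L (gs : seq (gate L)) : 'M[C]_(2 ^ L) :=
  foldl (fun acc g => gate_mx g *m acc) 1%:M gs.

Definition P_in n (Cm : 'M[C]_n) := adj Cm *m Cm.
Definition P_out n (Cm : 'M[C]_n) := Cm *m adj Cm.

(** Unnormalized amplitude of |phi> = sum_s (C|s>)_P (x) |s>_R on 2L qubits: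
    basis index x = i + 2^L * j, qubits 0..L-1 are P (i), qubits L..2L-1 are R (j). *)
Definition phi_amp L (Cm : 'M[C]_(2 ^ L)) (x : nat) : C :=
  \sum_(i < 2 ^ L) \sum_(j < 2 ^ L) (if x == (i + 2 ^ L * j)%N then Cm i j else 0).

Definition vanish_on n (S : {set 'I_n}) (x : nat) : bool :=
  [forall q : 'I_n, (q \in S) ==> ~~ qbit x q].

(** Reduced density matrix of the normalized state with amplitudes psi on the
    qubit subset X, padded by zeros to a 2^n x 2^n matrix: its entry (x,y), for
    x,y supported on X, is  sum_e psi(x+e) conj(psi(y+e)) / <psi|psi>, with e
    ranging over configurations of the complement of X. *)
Definition reduced_rho n (psi : nat -> C) (X : {set 'I_n}) : 'M[C]_(2 ^ n) :=
  \matrix_(x, y)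
    (if vanish_on (~: X) x && vanish_on (~: X) y then
       (\sum_(e < 2 ^ n | vanish_on X e) psi (x + e)%N * conjc (psi (y + e)%N))
       / (\sum_(z < 2 ^ n) psi z * conjc (psi z))
     else 0).

Definition eigenvalues n (M : 'M[C]_n) : seq C :=
  sval (closed_field_poly_normal (char_poly M)).

Definition eta2 (t : R) : R := if t == 0 then 0 else - (t * ln t / ln 2).

Definition vn_entropy n (M : 'M[C]_n) : R :=
  \sum_(z <- eigenvalues M) eta2 (complex.Re z).

Definition P_sites L (B : {set 'I_L}) : {set 'I_(L + L)} := [set lshift L b | b in B].
Definition R_sites L (A : {set 'I_L}) : {set 'I_(L + L)} := [set rshift L a | a in A].

Definition mutual_info L (Cm : 'M[C]_(2 ^ L)) (A B : {set 'I_L}) : R :=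
  let psi := phi_amp Cm in
  vn_entropy (reduced_rho psi (R_sites A)) + vn_entropy (reduced_rho psi (P_sites B))
  - vn_entropy (reduced_rho psi (R_sites A :|: P_sites B)).

(** O_1..O_k: Pauli logical operators of the input code supported on A, each
    transferred by C to a Pauli logical operator of the output code supported
    on B, and independent & inequivalent: no nonempty product of them acts on
    the input code space as a multiple of the identity. *)
Definition transferable_family L (Cm : 'M[C]_(2 ^ L)) (A B : {set 'I_L})
    k (O : 'I_k -> 'M[C]_(2 ^ L)) : Prop :=
  (forall i, [/\ pauli_on A (O i), O i *m P_in Cm = P_in Cm *m O i &
     exists Ot : 'M[C]_(2 ^ L), [/\ pauli_on B Ot, Ot *m P_out Cm = P_out Cm *m Ot &
                                 Cm *m O i = Ot *m Cm]]) /\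
  (forall S : {set 'I_k}, S != set0 ->
     ~ exists c : C, (\big[@mulmx C _ _ _/1%:M]_(i in S) O i) *m P_in Cm = c *: P_in Cm).

End QuantumClifford.

(* Main.v *)
Require Import Defs.
From HB Require Import structures.
From mathcomp Require Import all_boot all_order all_algebra.
From mathcomp Require Import reals exp.
From mathcomp Require Import complex.
From mathcomp Require Import ring.
Import Order.TTheory GRing.Theory Num.Theory.
Local Open Scope ring_scope.
Set Implicit Arguments. Unset Strict Implicit. Unset Printing Implicit Defensive.

(** Call [M] flat if every pair of Pauli strings [P], [Q] either satisfies [P M Q = c M]
for some scalar [c] or has [tr (M^* P M Q) = 0]. The identity is flat, and flatness
survives composition with a Clifford unitary (which permutes Pauli strings) and with a
projector [(1 + s Z) / 2] (a string anticommuting with [Z] is annihilated; for a commuting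
[P] the trace is half the sum of those of [P] and [s P Z]). So the state of [C] is a
stabilizer state. Expanding its reduced density matrix on a set [X] of qubits in Pauli
strings gives [rho^2 = l rho] with [l = |G_X| / 2^|X|], where [G_X] is the group of
stabilizers supported on [X]; hence [S_X = |X| - log2 |G_X|]. The stabilizers on [A_R] and
[B_P] together are the pairs ([Q] on [B], [P] on [A]) with [Q C P = +-C], and they fibre
over the group [H] of transferable [P], with fibre the group of stabilizers on [B_P].
Therefore [I = log2 (|H| / |T|)], where [T] is the group of trivial logical operators on
[A], i.e. the dimension over F_2 of [H / T]. *)

(** * Binary digits *)

Lemma qbit_expansion n x :
  (x %% 2 ^ n = \sum_(k < n) qbit x k * 2 ^ k)%N.
Proof.
elim: n => [|n IHn]; first by rewrite big_ord0 modn1.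
rewrite big_ord_recr /= -IHn /qbit.
have -> : nat_of_bool (odd (x %/ 2 ^ n)) = ((x %/ 2 ^ n) %% 2)%N by rewrite modn2.
set d := (2 ^ n)%N; have d0 : (0 < d)%N by rewrite expn_gt0.
set q := (x %/ d)%N; have defx : (x = q %/ 2 * (2 * d) + (x %% d + q %% 2 * d))%N.
  by rewrite mulnA addnCA -mulnDl -divn_eq addnC -divn_eq.
rewrite [in LHS]defx expnS modnMDl modn_small //.
have lt2 : (q %% 2 < 2)%N by rewrite ltn_mod.
apply: (@leq_trans ((q %% 2).+1 * d)%N); last by rewrite leq_mul2r lt2 orbT.
by rewrite mulSn ltn_add2r ltn_mod.
Qed.

(** Since i < 2^L, no carry mixes the digits of i and j in the index [i + 2 ^ L * j] of [phi_amp];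
    this makes P the low qubits and R the high ones. *)
Lemma qbit_split L (i j k : nat) : (i < 2 ^ L)%N ->
  qbit (i + 2 ^ L * j) k = if (k < L)%N then qbit i k else qbit j (k - L).
Proof.
move=> lti; rewrite /qbit; case: ltnP => [ltk|lek].
  (* Shifted down by k < L places, the summand [2 ^ L * j] is even and leaves the digit alone. *)
  have -> : (2 ^ L = 2 ^ (L - k) * 2 ^ k)%N by rewrite -expnD subnK // ltnW.
  rewrite mulnAC divnDMl ?expn_gt0 // oddD oddM oddX.
  by rewrite subn_eq0 leqNgt ltk /= addbF.
have -> : (2 ^ k = 2 ^ L * 2 ^ (k - L))%N by rewrite -expnD subnKC.
rewrite divnMA addnC mulnC divnMDl ?expn_gt0 //.
by rewrite (divn_small lti) addn0.
Qed.

Section Bits.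
Variable n : nat.
Implicit Types x y e : 'I_(2 ^ n).

Definition bits (x : 'I_(2 ^ n)) : {ffun 'I_n -> bool} := [ffun k : 'I_n => qbit x k].

Lemma bits_inj : injective bits.
Proof.
move=> x y /ffunP eq_xy; apply: val_inj.
rewrite /= -(modn_small (ltn_ord x)) -(modn_small (ltn_ord y)) !qbit_expansion.
by apply: eq_bigr => k _; have := eq_xy k; rewrite !ffunE => ->.
Qed.

Lemma bits_card : (#|{ffun 'I_n -> bool}| <= #|'I_(2 ^ n)|)%N.
Proof. by rewrite card_ffun card_bool !card_ord. Qed.

Definition of_bits (f : {ffun 'I_n -> bool}) : 'I_(2 ^ n) :=
  iinv (inj_card_onto bits_inj bits_card f).

Lemma of_bitsK : cancel of_bits bits.
Proof. by move=> f; rewrite /of_bits f_iinv. Qed.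

Lemma bitsK : cancel bits of_bits.
Proof. by move=> x; apply: bits_inj; rewrite of_bitsK. Qed.

Lemma sum_bits (V : nmodType) (F : {ffun 'I_n -> bool} -> V) :
  \sum_(x < 2 ^ n) F (bits x) = \sum_f F f.
Proof.
rewrite [RHS](reindex bits) //.
by exists of_bits => f _; rewrite ?of_bitsK ?bitsK.
Qed.

(** Distributivity, read over basis states. Matrix products and traces of tensor products reduce to
    one-qubit sums through it. *)
Lemma prod_sum_qbit (S : comPzSemiRingType) (F : 'I_n -> bool -> S) :
  \sum_(x < 2 ^ n) \prod_(k < n) F k (qbit x k) = \prod_(k < n) \sum_b F k b.
Proof.
rewrite bigA_distr_bigA -sum_bits; apply: eq_bigr => x _.
by apply: eq_bigr => k _; rewrite ffunE.
Qed.

Lemma of_bitsE f (k : 'I_n) : qbit (of_bits f) k = f k.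
Proof. by rewrite -{2}(of_bitsK f) ffunE. Qed.

Lemma qbit_inj x y : (forall k : 'I_n, qbit x k = qbit y k) -> x = y.
Proof. by move=> eq_xy; apply: bits_inj; apply/ffunP => k; rewrite !ffunE. Qed.

(** Without a common binary 1 no carry occurs. [reduced_rho] glues configurations of complementary
    sites by such sums. *)
Lemma addn_disjoint x e : (forall k : 'I_n, ~~ (qbit x k && qbit e k)) ->
  (x + e)%N = of_bits [ffun k : 'I_n => qbit x k || qbit e k].
Proof.
move=> dis; have expand (y : 'I_(2 ^ n)) : (y = \sum_(k < n) qbit y k * 2 ^ k :> nat)%N.
  by rewrite -qbit_expansion modn_small.
rewrite (expand (of_bits _)) [in LHS](expand x) [in LHS](expand e) -big_split /=.
apply: eq_bigr => k _; rewrite -mulnDl of_bitsE ffunE; congr (_ * _)%N.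
by have := dis k; case: (qbit x k); case: (qbit e k).
Qed.

End Bits.

(** * Independent families modulo a subgroup of an elementary abelian 2-group *)

Section Independence.
Variable V : finZmodType.
Hypothesis addpp : forall p : V, p + p = 0.
Implicit Types (p q h : V) (T H : {set V}).

(** Together with membership of 0 this makes T a subgroup, every element being its own inverse. *)
Definition closed_add T := forall p q, p \in T -> q \in T -> p + q \in T.

Definition independent_mod T k (p : 'I_k -> V) :=
  forall S : {set 'I_k}, S != set0 -> \sum_(i in S) p i \notin T.

Lemma addpK p q : p + (p + q) = q.
Proof. by rewrite addrA addpp add0r. Qed.

Lemma sum_set_recl k (p : 'I_k.+1 -> V) (S : {set 'I_k.+1}) :
  \sum_(i in S) p i =
  (if ord0 \in S then p ord0 else 0) + \sum_(i in lift ord0 @^-1: S) p (lift ord0 i).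
Proof.
rewrite big_mkcond big_ord_recl; congr (_ + _).
by rewrite [RHS]big_mkcond; apply: eq_bigr => i _; rewrite inE.
Qed.

(** The subgroup generated by a subgroup T and h: T and its coset h + T, the latter written with h
    on the other side since -h = h. *)
Definition extend T h : {set V} := T :|: [set p | h + p \in T].

Lemma in_extend T h p : (p \in extend T h) = (p \in T) || (h + p \in T).
Proof. by rewrite !inE. Qed.

Lemma closed_extend T h : closed_add T -> closed_add (extend T h).
Proof.
move=> clT p q; rewrite !in_extend => /orP[Tp|Thp] /orP[Tq|Thq].
- by rewrite (clT _ _ Tp Tq).
- by rewrite [h + (p + q)]addrCA (clT _ _ Tp Thq) orbT.
- by rewrite [h + (p + q)]addrA (clT _ _ Thp Tq) orbT.
- have -> : p + q = (h + p) + (h + q) by rewrite addrACA addpp add0r.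
  by rewrite (clT _ _ Thp Thq).
Qed.

Lemma card_extend T h : closed_add T -> h \notin T -> #|extend T h| = (2 * #|T|)%N.
Proof.
move=> clT nTh; rewrite /extend cardsU.
have -> : T :&: [set p | h + p \in T] = set0.
  apply/setP => p; rewrite !inE; apply/negP => /andP[Tp Thp].
  by case/negP: nTh; rewrite -(addpK p h) clT // addrC.
rewrite cards0 subn0 mul2n -addnn; congr (_ + _)%N.
rewrite -(card_imset (mem T) (addrI h)); apply: eq_card => p; rewrite !inE.
by apply/idP/imsetP => [Tp|[q Tq ->]]; [exists (h + p) | rewrite ?addpK]; rewrite ?addpK.
Qed.

Lemma extend_sub T H h : closed_add H -> T \subset H -> h \in H -> extend T h \subset H.
Proof.
move=> clH sTH Hh; apply/subsetP => p; rewrite in_extend => /orP[|/(subsetP sTH) Hp].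
  exact: (subsetP sTH).
by rewrite -(addpK h p) clH.
Qed.

(** Absorbing the first element into T doubles T, and the others stay independent modulo the
    enlarged group: its two cosets account for subsets without and with the first element. *)
Lemma independent_card k T H (p : 'I_k -> V) :
    closed_add T -> closed_add H -> T \subset H -> 0 \in T ->
    (forall i, p i \in H) -> independent_mod T p ->
  (2 ^ k * #|T| <= #|H|)%N.
Proof.
elim: k T p => [|k IHk] T p clT clH sTH T0 Hp ind; first by rewrite mul1n subset_leq_card.
have nTp : p ord0 \notin T.
  have := ind [set ord0]; rewrite big_set1; apply; apply/set0Pn; exists ord0.
  by rewrite inE.
rewrite expnSr -mulnA -(card_extend clT nTp).
apply: (IHk _ (fun i => p (lift ord0 i))) => //.
- exact: closed_extend.
- exact: extend_sub.
- by rewrite in_extend T0.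
move=> S /set0Pn[i Si]; rewrite in_extend; apply/norP; split.
  have := ind (lift ord0 @: S); rewrite big_imset /=; last by move=> ? ? _ _ /lift_inj.
  by apply; apply/set0Pn; exists (lift ord0 i); rewrite imset_f.
have := ind (ord0 |: lift ord0 @: S); rewrite big_setU1 /=; last first.
  by apply/imsetP => -[j _] /eqP; rewrite eq_liftF || rewrite (negbTE (neq_lift _ _)).
rewrite big_imset /=; last by move=> ? ? _ _ /lift_inj.
by apply; apply/set0Pn; exists ord0; rewrite setU11.
Qed.

(** Greedy choice: while T differs from H, adjoin some h of H outside T. Each step doubles T. *)
Lemma independent_exists T H :
    closed_add T -> closed_add H -> T \subset H -> 0 \in T ->
  exists k (p : 'I_k -> V),
    [/\ forall i, p i \in H, independent_mod T p & #|H| = (2 ^ k * #|T|)%N].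
Proof.
(* Induction on a bound for |H| - |T|, which drops because doubling the nonempty T adds at least one
   element. *)
move: {2}(#|H| - #|T|)%N (leqnn (#|H| - #|T|)) => m.
elim: m T => [|m IHm] T lem clT clH sTH T0.
  exists 0%N, (fun=> 0); split; first by case.
    by move=> S /set0Pn[[]].
  by apply/eqP; rewrite mul1n eqn_leq -subn_eq0 -leqn0 lem subset_leq_card.
have [eqTH|] := eqVneq T H.
  exists 0%N, (fun=> 0); split; first by case.
    by move=> S /set0Pn[[]].
  by rewrite mul1n eqTH.
rewrite eqEsubset sTH => /subsetPn[h Hh nTh].
have sub := extend_sub clH sTH Hh.
have [|||||k [p [Hp ind card]]] := IHm (extend T h).
- have T_gt0 : (0 < #|T|)%N by apply/card_gt0P; exists 0.
  rewrite card_extend // leq_subLR; rewrite leq_subLR in lem.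
  by apply: leq_trans lem _; rewrite mul2n -addnn addnS -addSn leq_add2r -(add1n #|T|) leq_add2r.
- exact: closed_extend.
- by [].
- by [].
- by rewrite in_extend T0.
exists k.+1, (fun i => oapp p h (unlift ord0 i)); split.
- by move=> i; case: unliftP => [j|] _ /=.
- move=> S; rewrite sum_set_recl unlift_none /=.
  under eq_bigr => i _ do rewrite liftK /=.
  (* Lying outside [extend T h] excludes both cosets: h + T settles the S that contain the new
     index, T the others. Only when S' is empty is [nTh] needed. *)
  set S' := _ @^-1: S => nS0; have := ind S'; rewrite in_extend.
  case: ifP => S0; rewrite ?add0r.
    have [->|_ /(_ isT) /norP[]//] := eqVneq S' set0.
    by rewrite big_set0 addr0.
  case/set0Pn: nS0 => i; case: (unliftP ord0 i) => [j|] -> Si; last by rewrite Si in S0.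
  have S'0 : S' != set0 by apply/set0Pn; exists j; rewrite inE.
  by move/(_ S'0)/norP => [].
- by rewrite card card_extend // mulnA -expnSr.
Qed.

End Independence.

(** * Pauli strings *)

(** A Pauli string up to phase: the pair at site [k] holds the exponents of [X] and of [Z]. *)
Definition pstr n := {ffun 'I_n -> bool * bool}.
HB.instance Definition _ n := GRing.Zmodule.on (pstr n).
HB.instance Definition _ n := Finite.on (pstr n).

Lemma pstr_addpp n (p : pstr n) : p + p = 0.
Proof. by apply/ffunP => k; rewrite !ffunE; case: (p k) => -[] []. Qed.

Definition pauli_of (u : bool * bool) : pauli1 :=
  match u with
  | (false, false) => PI
  | (true, false) => PX
  | (true, true) => PY
  | (false, true) => PZ
  end.

Definition code_of (t : pauli1) : bool * bool :=
  match t with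
  | PI => (false, false)
  | PX => (true, false)
  | PY => (true, true)
  | PZ => (false, true)
  end.

Lemma code_ofK : cancel code_of pauli_of.
Proof. by case. Qed.

Definition supported n (X : {set 'I_n}) (p : pstr n) :=
  [forall k, (k \notin X) ==> (p k == 0)].

Lemma supportedP n (X : {set 'I_n}) (p : pstr n) :
  reflect (forall k, k \notin X -> p k = 0) (supported X p).
Proof.
by apply: (iffP forall_inP) => s k nXk; apply/eqP/s.
Qed.

Lemma supported0 n (X : {set 'I_n}) : supported X 0.
Proof. by apply/supportedP => k _; rewrite ffunE. Qed.

Lemma supportedD n (X : {set 'I_n}) p q :
  supported X p -> supported X q -> supported X (p + q).
Proof.
move=> /supportedP sp /supportedP sq; apply/supportedP => k nXk.
by rewrite ffunE sp // sq // addr0.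
Qed.

Section PauliMatrices.
Variable R : realType.
Local Notation C := R[i].
Local Notation sig u := (pauli1_mx R (pauli_of u)).

Lemma i_mul_i : 'i%C * 'i%C = -1 :> C.
Proof. by rewrite -expr2 sqr_i. Qed.

(** The scalar in a product of two letters: XY = iZ and cyclically, -i in the opposite order, and 1
    if the letters agree or one is I. *)
Definition phase1 (u v : bool * bool) : C :=
  match pauli_of u, pauli_of v with
  | PX, PY | PY, PZ | PZ, PX => 'i%C
  | PY, PX | PZ, PY | PX, PZ => - 'i%C
  | _, _ => 1
  end.

Ltac simpC := rewrite ?(mulr0, mul0r, addr0, add0r, mulr1, mul1r, mulrN1, mulN1r,
  mulrN, mulNr, opprK, i_mul_i, oppr0, subrr).

Lemma pauli1_mul u v a c :
  \sum_b sig u a b * sig v b c = phase1 u v * sig (u + v) a c.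
Proof.
rewrite big_bool; case: u v a c => [[] []] [[] []] [] [] /=; simpC => //.
all: by rewrite /phase1 /=; simpC.
Qed.

Lemma phase1_exp4 u v : phase1 u v ^+ 4 = 1.
Proof.
have i4 : 'i%C ^+ 4 = 1 :> C by rewrite (exprM _ 2 2) sqr_i sqrrN expr1n.
rewrite /phase1; case: (pauli_of u) (pauli_of v) => [] []; rewrite ?expr1n //.
all: by rewrite exprNn i4 mulr1 -signr_odd expr0.
Qed.

Lemma pauli1_conj u a b : conjc (sig u b a) = sig u a b.
Proof.
by case: u a b => [[] []] [] [] /=; rewrite ?(conjc0, conjc1) //; apply/eqP;
  rewrite eq_complex /= ?oppr0 ?opprK !eqxx.
Qed.

Lemma pauli1_transpose u a b : sig u b a = (if u == (true, true) then -1 else 1) * sig u a b.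
Proof. by case: u a b => [[] []] [] [] /=; simpC. Qed.

Lemma pauli1_trace u : \sum_b sig u b b = if u == 0 then 2 else 0.
Proof. by rewrite big_bool; case: u => [[] []] /=; simpC; rewrite ?addNr. Qed.

(** In entries: the sum of [sig u] tensored with itself over the four letters is twice the swap of
    two qubits. *)
Lemma pauli1_swap a b x y :
  \sum_u sig u a b * sig u x y = if (a == y) && (b == x) then 2 else 0.
Proof.
transitivity (\sum_s \sum_t sig (s, t) a b * sig (s, t) x y).
  by rewrite pair_bigA; apply: eq_bigr => -[].
rewrite !big_bool /=.
by case: a b x y => [] [] [] [] /=; simpC; rewrite ?addNr ?opprK ?subrr ?addrN.
Qed.

Section Strings.
Variable n : nat.
Implicit Types p q : pstr n.

Definition pauli p : 'M[C]_(2 ^ n) := pauli_mx 1 (fun k => pauli_of (p k)).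

Lemma pauliE p x y : pauli p x y = \prod_(k < n) sig (p k) (qbit x k) (qbit y k).
Proof. by rewrite mxE mul1r. Qed.

Definition phase p q : C := \prod_(k < n) phase1 (p k) (q k).

Lemma phase_exp4 p q : phase p q ^+ 4 = 1.
Proof. by rewrite -prodrXl big1 // => k _; rewrite phase1_exp4. Qed.

Lemma exp4_neq0 (c : C) : c ^+ 4 = 1 -> c != 0.
Proof. by move=> c4; apply/eqP => c0; move/eqP: c4; rewrite c0 expr0n eq_sym oner_eq0. Qed.

Lemma phase_neq0 p q : phase p q != 0.
Proof. exact: exp4_neq0 (phase_exp4 p q). Qed.

Lemma pauli_mul p q : pauli p *m pauli q = phase p q *: pauli (p + q).
Proof.
apply/matrixP => x z; rewrite !mxE mul1r.
under eq_bigr => y _ do rewrite !pauliE -big_split /=.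
rewrite (prod_sum_qbit (fun k b => sig (p k) (qbit x k) b * sig (q k) b (qbit z k))).
by rewrite -big_split /=; apply: eq_bigr => k _; rewrite pauli1_mul !ffunE.
Qed.

Lemma pauli0 : pauli 0 = 1%:M.
Proof.
apply/matrixP => x y; rewrite pauliE mxE.
have [->|neq] := eqVneq x y.
  by rewrite big1 // => k _; rewrite ffunE /= eqxx.
have [k neqk|eqxy] := pickP (fun k : 'I_n => qbit x k != qbit y k).
  by rewrite (bigD1 k) //= ffunE /= (negbTE neqk) mul0r.
case/eqP: neq; apply: qbit_inj => k; apply/eqP; exact/negbFE/eqxy.
Qed.

Lemma pauli_sqr p : pauli p *m pauli p = 1%:M.
Proof.
rewrite pauli_mul pstr_addpp pauli0 /phase big1 ?scale1r // => k _.
by case: (p k) => -[] [].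
Qed.

Lemma pauli_adj p : adj (pauli p) = pauli p.
Proof.
apply/matrixP => x y; rewrite mxE !pauliE rmorph_prod /=.
by apply: eq_bigr => k _; rewrite pauli1_conj.
Qed.

Definition transpose_sign p : C := \prod_(k < n) (if p k == (true, true) then -1 else 1).

Lemma transpose_sign_neq0 p : transpose_sign p != 0.
Proof. by apply/prodf_neq0 => k _; case: ifP; rewrite ?oppr_eq0 oner_eq0. Qed.

Lemma pauli_transpose p : (pauli p)^T = transpose_sign p *: pauli p.
Proof.
apply/matrixP => x y; rewrite !mxE !mul1r -big_split /=.
by apply: eq_bigr => k _; rewrite pauli1_transpose.
Qed.

Lemma pauli_trace p : \tr (pauli p) = if p == 0 then (2 ^ n)%:R else 0.
Proof.
rewrite /mxtrace; under eq_bigr => x _ do rewrite pauliE.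
rewrite (prod_sum_qbit (fun k b => sig (p k) b b)).
have [->|neq] := eqVneq p 0.
  rewrite (eq_bigr (fun=> 2)) ?prodr_const ?card_ord ?natrX //.
  by move=> k _; rewrite pauli1_trace ffunE eqxx.
have [k neqk|eqp] := pickP (fun k : 'I_n => p k != 0).
  by rewrite (bigD1 k) //= pauli1_trace (negbTE neqk) mul0r.
case/eqP: neq; apply/ffunP => k; rewrite ffunE; apply/eqP; exact/negbFE/eqp.
Qed.

(** The sum factors over sites: a site of X contributes twice a swap, any other site only the
    identity letter. Both completeness (X everything) and the partial trace onto X come from this
    identity. *)
Lemma pauli_swap (X : {set 'I_n}) (a b x y : 'I_(2 ^ n)) :
  \sum_(p | supported X p) pauli p a b * pauli p x y =
  \prod_(k < n) (if k \in X then
     if (qbit a k == qbit y k) && (qbit b k == qbit x k) then 2 else 0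
   else if (qbit a k == qbit b k) && (qbit x k == qbit y k) then 1 else 0).
Proof.
(* The support condition at one site; with it the sum over strings becomes a sum over independent
   choices of letters. *)
pose Q (k : 'I_n) : pred (bool * bool) := fun u => (k \notin X) ==> (u == 0).
transitivity (\prod_(k < n) \sum_(u | Q k u)
    sig u (qbit a k) (qbit b k) * sig u (qbit x k) (qbit y k)).
  rewrite bigA_distr_big_dep /=; apply: eq_big => [p|p _]; last first.
    by rewrite !pauliE -big_split.
  by [].
apply: eq_bigr => k _; rewrite /Q; case: (boolP (k \in X)) => Xk /=.
  by rewrite pauli1_swap.
by rewrite big_pred1_eq /= ; do 2!case: eqP => _; rewrite ?mulr0 ?mul0r ?mulr1.
Qed.

Lemma pauli_complete (M : 'M[C]_(2 ^ n)) :
  \sum_p \tr (pauli p *m M) *: pauli p = (2 ^ n)%:R *: M.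
Proof.
apply/matrixP => x y; rewrite summxE mxE.
transitivity (\sum_(a < 2 ^ n) \sum_(b < 2 ^ n)
    (\sum_(p | supported setT p) pauli p a b * pauli p x y) * M b a).
  under eq_bigr => p _ do rewrite mxE /mxtrace mulr_suml.
  rewrite exchange_big /=; apply: eq_bigr => a _.
  under eq_bigr => p _ do rewrite mxE mulr_suml.
  rewrite exchange_big /=; apply: eq_bigr => b _.
  rewrite mulr_suml; apply: eq_big => [p|p _]; last by rewrite mulrAC.
  by apply/esym/supportedP => k; rewrite inE.
rewrite (bigD1 y) //= (bigD1 x) //= pauli_swap.
rewrite (eq_bigr (fun=> 2)) => [|k _]; last by rewrite inE !eqxx.
rewrite prodr_const card_ord natrX !big1 ?addr0 // => [a neq|b neq].
  rewrite big1 // => b _; rewrite pauli_swap.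
  have [k neqk|eqay] := pickP (fun k : 'I_n => qbit a k != qbit y k).
    by rewrite (bigD1 k) //= inE (negbTE neqk) !mul0r.
  by case/eqP: neq; apply: qbit_inj => k; apply/eqP; exact/negbFE/eqay.
rewrite pauli_swap.
have [k neqk|eqbx] := pickP (fun k : 'I_n => qbit b k != qbit x k).
  by rewrite (bigD1 k) //= inE (negbTE neqk) andbF !mul0r.
by case/eqP: neq; apply: qbit_inj => k; apply/eqP; exact/negbFE/eqbx.
Qed.

End Strings.
End PauliMatrices.

(** * Flat operators *)

Section Dynamics.
Variable R : realType.
Local Notation C := R[i].
Local Notation sig u := (pauli1_mx R (pauli_of u)).

Lemma adj_mulmx n (M N : 'M[C]_n) : adj (M *m N) = adj N *m adj M.
Proof.
apply/matrixP => x y; rewrite !mxE rmorph_sum /=.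
by apply: eq_bigr => z _; rewrite !mxE rmorphM mulrC.
Qed.

Lemma adj_involutive n (M : 'M[C]_n) : adj (adj M) = M.
Proof. by apply/matrixP => x y; rewrite !mxE conjcK. Qed.

Lemma adj_scalemx n (c : C) (M : 'M[C]_n) : adj (c *: M) = conjc c *: adj M.
Proof. by apply/matrixP => x y; rewrite !mxE rmorphM. Qed.

Lemma trace_adj_mul n (M : 'M[C]_n) :
  \tr (adj M *m M) = \sum_i \sum_j M i j * conjc (M i j).
Proof.
rewrite /mxtrace exchange_big /=; apply: eq_bigr => j _; rewrite mxE.
by apply: eq_bigr => i _; rewrite mxE mulrC.
Qed.

Lemma trace_adj_mul_eq0 n (M : 'M[C]_n) : (\tr (adj M *m M) == 0) = (M == 0).
Proof.
apply/eqP/eqP => [|->]; last by rewrite mulmx0 mxtrace0.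
rewrite trace_adj_mul => tr0; apply/matrixP => i j; rewrite mxE.
have ge0 i' : true -> 0 <= \sum_j M i' j * conjc (M i' j).
  by move=> _; apply: sumr_ge0 => j' _; exact: mulcJ_ge0.
have /eqP : \sum_j M i j * conjc (M i j) = 0 by apply: (psumr_eq0P ge0 tr0).
rewrite psumr_eq0 => [/allP/(_ j)|? _]; last exact: mulcJ_ge0.
by rewrite mem_index_enum => /(_ isT) /=; rewrite mulf_eq0 conjc_eq0 orbb => /eqP.
Qed.

(** The hypothesis concerns U P U^* only, so the inverse direction has to be derived. U^* P U is
    nonzero, hence by completeness overlaps some string Q; then U Q U^* is a string overlapping P,
    so it is P up to a scalar. *)
Lemma clifford_adj n (U : 'M[C]_(2 ^ n)) : unitary U ->
    (forall P, is_pauli P -> is_pauli (U *m P *m adj U)) ->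
  forall p : pstr n, exists (c : C) (q : pstr n), adj U *m pauli R p *m U = c *: pauli R q.
Proof.
move=> uU cU p; have uU' : adj U *m U = 1%:M by apply: mulmx1C.
set M := adj U *m pauli R p *m U.
have defP : U *m M *m adj U = pauli R p.
  by rewrite /M !mulmxA uU mul1mx -mulmxA uU mulmx1.
have M0 : M != 0.
  apply/eqP => M0; have := pauli_sqr R p; rewrite -defP M0 mulmx0 !mul0mx => /esym/eqP.
  by rewrite -[_ == 0]negbK => /negP[]; rewrite -pauli0 -trace_adj_mul_eq0 pauli_adj
    pauli_sqr mxtrace1 pnatr_eq0 expn_eq0.
have [q trq|tr0] := pickP (fun q => \tr (pauli R q *m M) != 0); last first.
  case/eqP: M0; apply/eqP; have /eqP := pauli_complete M.
  rewrite big1 => [|q _]; last by rewrite (eqP (negbFE (tr0 q))) scale0r.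
  by rewrite eq_sym scaler_eq0 pnatr_eq0 expn_eq0 /=.
have [d [r [d4 defq]]] : is_pauli (U *m pauli R q *m adj U).
  by apply: cU; exists 1, (fun k => pauli_of (q k)); rewrite expr1n.
pose r' : pstr n := [ffun k => code_of (r k)].
have {}defq : U *m pauli R q *m adj U = d *: pauli R r'.
  rewrite defq; apply/matrixP => x y; rewrite !mxE mul1r; congr (_ * _).
  by apply: eq_bigr => k _; rewrite ffunE code_ofK.
have d0 := exp4_neq0 d4.
(* By cyclicity the overlap is, up to a scalar, the trace of [r'] times p, and distinct strings are
   trace-orthogonal. *)
have eq_rp : r' = p.
  apply/eqP; move: trq; rewrite /M !mulmxA mxtrace_mulC !mulmxA.
  rewrite defq -scalemxAl pauli_mul !mxtraceZ pauli_trace.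
  have [e _|_] := eqVneq (r' + p) 0; first by rewrite -[r']addr0 -(pstr_addpp p) addrA e add0r.
  by rewrite !mulr0 eqxx.
exists d^-1, q; rewrite /M -eq_rp -[pauli R r'](scalerK d0) -defq.
by rewrite -scalemxAr -scalemxAl !mulmxA uU' mul1mx -mulmxA uU' mulmx1.
Qed.

(** For [M != 0], flatness says that [M], viewed as a bipartite state, is a stabilizer state:
    each Pauli string on the two sides either stabilizes [M] up to a scalar or has
    vanishing expectation. *)
Definition pauli_flat n (M : 'M[C]_(2 ^ n)) := forall p q : pstr n,
  (exists c, pauli R p *m M *m pauli R q = c *: M) \/
  \tr (adj M *m (pauli R p *m M *m pauli R q)) = 0.

Lemma pauli_flat1 n : pauli_flat (1%:M : 'M[C]_(2 ^ n)).
Proof.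
move=> p q; rewrite mulmx1 pauli_mul.
have -> : adj 1%:M = 1%:M :> 'M[C]_(2 ^ n) by rewrite -(pauli0 R n) pauli_adj.
rewrite mul1mx mxtraceZ pauli_trace; case: eqP => [->|_]; last by right; rewrite mulr0.
by left; exists (phase R p q); rewrite pauli0.
Qed.

(** P U is a multiple of U P', and U cancels in the trace, so each alternative for (P', Q) on M
    passes to (P, Q) on U M. *)
Lemma pauli_flat_unitary n (U M : 'M[C]_(2 ^ n)) : U *m adj U = 1%:M ->
    (forall p : pstr n, exists (c : C) (q : pstr n), adj U *m pauli R p *m U = c *: pauli R q) ->
  pauli_flat M -> pauli_flat (U *m M).
Proof.
move=> uU cU fM p q; have [c [p' defp]] := cU p.
have PU : pauli R p *m U = c *: (U *m pauli R p').
  by rewrite scalemxAr -defp !mulmxA uU mul1mx.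
have [[d defM]|tr0] := fM p' q; [left|right].
  exists (c * d).
  by rewrite (mulmxA _ U) PU -!scalemxAl -!mulmxA (mulmxA (pauli R p')) defM -scalemxAr scalerA.
have uU' : adj U *m U = 1%:M by apply: mulmx1C.
have -> : pauli R p *m (U *m M) *m pauli R q = c *: (U *m (pauli R p' *m M *m pauli R q)).
  by rewrite (mulmxA _ U) PU -!scalemxAl !mulmxA.
rewrite adj_mulmx -scalemxAr mxtraceZ -(mulmxA (adj M)) (mulmxA (adj U)) uU' mul1mx.
by rewrite tr0 mulr0.
Qed.

Lemma meas_pauli_comm n (k : 'I_n) o (p : pstr n) : ~~ (p k).1 ->
  meas_mx R k o *m pauli R p = pauli R p *m meas_mx R k o.
Proof.
move=> pk; apply/matrixP => x y; rewrite !mxE.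
rewrite (bigD1 x) //= big1 ?addr0 => [|z]; last first.
  by rewrite eq_sym => /negbTE neq; rewrite mxE neq mul0r.
rewrite (bigD1 y) //= big1 ?addr0 => [|z /negbTE neq]; last first.
  by rewrite [meas_mx _ _ _ _ _]mxE neq mulr0.
rewrite mxE [meas_mx _ _ _ y y]mxE !eqxx /= mulrC.
have [->//|neq] := eqVneq (qbit x k) (qbit y k).
rewrite pauliE (bigD1 k) //=.
by case: (p k) pk => -[] [] //= _; rewrite (negbTE neq) !mul0r.
Qed.

Lemma meas_pauli_meas0 n (k : 'I_n) o (p : pstr n) : (p k).1 ->
  meas_mx R k o *m pauli R p *m meas_mx R k o = 0.
Proof.
move=> pk; apply/matrixP => x y; rewrite !mxE big1 // => z _.
rewrite [meas_mx _ _ _ z y]mxE; case: ifP => [/andP[_ /eqP eqz]|_]; last by rewrite mulr0.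
rewrite mulr1 mxE big1 // => t _; rewrite mxE.
case: ifP => [/andP[/eqP <- /eqP eqx]|_]; last by rewrite mul0r.
rewrite pauliE (bigD1 k) //= eqx eqz.
by case: (p k) pk => -[] [] //= _; rewrite eqxx mul0r mulr0.
Qed.

Definition pauli_Z n (k : 'I_n) : pstr n := [ffun j => (false, j == k)].

Lemma pauli_ZE n (k : 'I_n) x y :
  pauli R (pauli_Z k) x y = if x == y then (-1) ^+ qbit x k else 0.
Proof.
have [<-|neq] := eqVneq x y.
  rewrite pauliE (bigD1 k) //= big1 => [|j neq]; rewrite ffunE ?(negbTE neq) /= eqxx //.
  by rewrite mulr1; case: qbit; rewrite ?expr1 ?expr0.
have [j neqj|eqxy] := pickP (fun j : 'I_n => qbit x j != qbit y j).
  by rewrite pauliE (bigD1 j) //= ffunE; case: (j == k); rewrite /= (negbTE neqj) mul0r.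
by case/eqP: neq; apply: qbit_inj => j; apply/eqP; exact/negbFE/eqxy.
Qed.

Lemma meas_mxE n (k : 'I_n) o :
  meas_mx R k o = 2^-1 *: (1%:M + (-1) ^+ o *: pauli R (pauli_Z k)).
Proof.
apply/matrixP => x y; rewrite 5!mxE pauli_ZE.
have [_|_] := eqVneq x y; last by rewrite mulr0 addr0 mulr0.
rewrite /= -signr_addb; case: (qbit x k) o => -[] //=.
- by rewrite mulVf // pnatr_eq0.
- by rewrite expr1 subrr mulr0.
- by rewrite expr1 subrr mulr0.
- by rewrite mulVf // pnatr_eq0.
Qed.

Lemma pauli_Z_meas n (k : 'I_n) o :
  pauli R (pauli_Z k) *m meas_mx R k o = (-1) ^+ o *: meas_mx R k o.
Proof.
rewrite meas_mxE -scalemxAr mulmxDr mulmx1 -scalemxAr pauli_sqr scalerA mulrC -scalerA.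
by congr (_ *: _); rewrite scalerDr scalerA -signr_addb addbb scale1r addrC.
Qed.

Lemma meas_adj n (k : 'I_n) o : adj (meas_mx R k o) = meas_mx R k o.
Proof.
apply/matrixP => x y; rewrite !mxE (eq_sym y); have [->|_] := eqVneq x y; last by rewrite andFb conjc0.
by case: ifP => _; rewrite ?(conjc1, conjc0).
Qed.

Lemma meas_idem n (k : 'I_n) o : meas_mx R k o *m meas_mx R k o = meas_mx R k o.
Proof.
rewrite {1}meas_mxE -scalemxAl mulmxDl mul1mx -scalemxAl pauli_Z_meas scalerA -signr_addb.
rewrite addbb scale1r scalerDr -scalerDl.
by rewrite -mulr2n -[2^-1 *+ 2]mulr_natr mulVf ?scale1r // pnatr_eq0.
Qed.

Lemma pauli_flat_meas n (k : 'I_n) o (M : 'M[C]_(2 ^ n)) :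
  pauli_flat M -> pauli_flat (meas_mx R k o *m M).
Proof.
move=> fM p q; set D := meas_mx R k o.
(* The exponent of X at k tells whether P anticommutes with Z at k; if it does, P vanishes between
   the two projectors. *)
have [pk|pk] := boolP (p k).1.
  right; rewrite adj_mulmx meas_adj.
  have -> : adj M *m D *m (pauli R p *m (D *m M) *m pauli R q)
      = adj M *m (D *m pauli R p *m D) *m (M *m pauli R q) by rewrite !mulmxA.
  by rewrite meas_pauli_meas0 // mulmx0 mul0mx mxtrace0.
have comm := meas_pauli_comm o pk.
set z := pauli_Z k; pose p' := p + z.
have defp' : pauli R p *m pauli R z = phase R p z *: pauli R p' by rewrite pauli_mul.
(* On the range of D the operator Z at k is a sign, so P and P' = P Z agree there up to a scalar. It
   is enough that one of them stabilizes M. *)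
have DP : pauli R p *m D = phase R p z * (-1) ^+ o *: (pauli R p' *m D).
  have defD : D = (-1) ^+ o *: (pauli R z *m D).
    by rewrite pauli_Z_meas scalerA -signr_addb addbb scale1r.
  by rewrite {1}defD -scalemxAr mulmxA defp' -scalemxAl scalerA [_ * phase _ _ _]mulrC.
have pk' : ~~ (p' k).1 by rewrite !ffunE /=; case: (p k) pk => -[].
have comm' := meas_pauli_comm o pk'.
have [[c defc]|tr1] := fM p q.
  left; exists c; rewrite mulmxA -comm -!mulmxA (mulmxA _ M) defc -scalemxAr //.
have [[c defc]|tr2] := fM p' q.
  left; exists (phase R p z * (-1) ^+ o * c).
  rewrite mulmxA DP -!scalemxAl -comm' -!mulmxA (mulmxA _ M) defc -scalemxAr.
  by rewrite !scalerA.
(* Now both traces on M vanish. D commutes with P, so a single D remains, and expanding it as half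
   of 1 + (-1)^o Z makes the new trace a combination of these two. *)
right; rewrite adj_mulmx meas_adj.
have -> : adj M *m D *m (pauli R p *m (D *m M) *m pauli R q)
    = adj M *m (pauli R p *m (D *m D) *m (M *m pauli R q)).
  by rewrite !mulmxA -(mulmxA _ D (pauli R p)) comm !mulmxA.
rewrite meas_idem /D meas_mxE -scalemxAr mulmxDr mulmx1 -scalemxAr defp'.
rewrite -scalemxAl mulmxDl -!scalemxAl -scalemxAr mulmxDr -!scalemxAr.
rewrite -(mulmxA (pauli R p)) in tr1; rewrite -(mulmxA (pauli R p')) in tr2.
by rewrite mxtraceZ mxtraceD !mxtraceZ tr1 tr2 !mulr0 addr0 mulr0.
Qed.

End Dynamics.

(** * Two-qubit gates *)

Section TwoQubitGates.
Variable R : realType.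
Local Notation C := R[i].
Local Notation sig u := (pauli1_mx R (pauli_of u)).
Variables (L : nat) (a b : 'I_L).
Hypothesis neq_ab : a != b.
Implicit Types (M N : 'M[C]_(2 ^ 2)) (p q : pstr L).

Local Notation off k := ((k != a) && (k != b)).

(** [M] on the qubits [a] and [b], tensored with the letters of [p] at the other sites. *)
Definition mixed M p : 'M[C]_(2 ^ L) := \matrix_(x, y)
  (M (loc2 x a b) (loc2 y a b) * \prod_(k | off k) sig (p k) (qbit x k) (qbit y k)).

Lemma qbit_loc2 x : (qbit (loc2 x a b) 0 = qbit x a) * (qbit (loc2 x a b) 1 = qbit x b).
Proof.
rewrite /loc2; case: (qbit x a) (qbit x b) => [] [].
all: by rewrite /= inordK.
Qed.

Lemma loc2_surj (j : 'I_4) (x : nat) :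
  qbit x a = qbit j 0 -> qbit x b = qbit j 1 -> loc2 x a b = j.
Proof.
rewrite /loc2 => -> ->; apply: val_inj; case: j => [[|[|[|[|//]]]]] lt4.
all: by rewrite /= inordK.
Qed.

Lemma prod_id_off x y :
  \prod_(k | off k) sig ((0 : pstr L) k) (qbit x k) (qbit y k) =
  if [forall k : 'I_L, off k ==> (qbit x k == qbit y k)] then 1 else 0.
Proof.
case: ifP => [/forall_inP eqxy|/negbT].
  by rewrite big1 // => k offk; rewrite ffunE /= (eqP (eqxy k offk)) eqxx.
rewrite negb_forall => /existsP[k]; rewrite negb_imply => /andP[offk neq].
by rewrite (bigD1 k) //= ffunE /= (negbTE neq) mul0r.
Qed.

Lemma gate2_mixed M : gate2_mx a b M = mixed M 0.
Proof.
apply/matrixP => x y; rewrite !mxE prod_id_off.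
by case: ifP; rewrite ?mulr1 ?mulr0.
Qed.

(** Basis states agreeing with x off a and b are determined by their digits at a and b, that is, by
    an index in ['I_4]. *)
Lemma sum_loc2 (V : nmodType) (x : nat) (F : 'I_4 -> V) :
  \sum_(y < 2 ^ L | [forall k : 'I_L, off k ==> (qbit x k == qbit y k)]) F (loc2 y a b) =
  \sum_j F j.
Proof.
pose h (j : 'I_4) := of_bits [ffun k : 'I_L =>
  if k == a then qbit j 0 else if k == b then qbit j 1 else qbit x k].
have hK j : loc2 (h j) a b = j.
  by apply: loc2_surj; rewrite of_bitsE ffunE eqxx // eq_sym (negbTE neq_ab).
rewrite (reindex_onto h (fun y : 'I_(2 ^ L) => loc2 y a b)) /=.
  apply: eq_big => j; last by rewrite hK.
  rewrite hK eqxx andbT; apply/forall_inP => k /andP[/negbTE nka /negbTE nkb].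
  by rewrite of_bitsE ffunE nka nkb.
move=> y /forall_inP eqxy; apply: qbit_inj => k; rewrite of_bitsE ffunE !qbit_loc2.
have [->//|nka] := eqVneq k a; have [->//|nkb] := eqVneq k b.
by apply/eqP/eqxy; rewrite nka.
Qed.

Lemma mixed_mul M N p : mixed M 0 *m mixed N p = mixed (M *m N) p.
Proof.
apply/matrixP => x z; rewrite !mxE.
rewrite big_distrl /= -(sum_loc2 x) /= [RHS]big_mkcond /=.
apply: eq_bigr => y _; rewrite !mxE prod_id_off.
case: ifP => [/forall_inP eqxy|_]; last by rewrite mulr0 mul0r.
rewrite mulr1 mulrA; congr (_ * _).
by apply: eq_bigr => k offk; rewrite (eqP (eqxy k offk)).
Qed.

Lemma mixed_adj M p : adj (mixed M p) = mixed (adj M) p.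
Proof.
apply/matrixP => x y; rewrite !mxE rmorphM rmorph_prod /=; congr (_ * _).
by apply: eq_bigr => k _; rewrite pauli1_conj.
Qed.

Lemma mixed_mulr M N p : mixed N p *m mixed M 0 = mixed (N *m M) p.
Proof.
by rewrite -[LHS]adj_involutive adj_mulmx !mixed_adj mixed_mul mixed_adj adj_mulmx !adj_involutive.
Qed.

Definition pair_string (u v : bool * bool) : pstr 2 :=
  [ffun k : 'I_2 => if k == ord0 then u else v].

Lemma pauli_pair u v i j :
  pauli R (pair_string u v) i j = sig u (qbit i 0) (qbit j 0) * sig v (qbit i 1) (qbit j 1).
Proof. by rewrite pauliE !big_ord_recl big_ord0 mulr1 !ffunE. Qed.

Lemma mixed_pauli u v p : mixed (pauli R (pair_string u v)) p =
  pauli R [ffun k => if k == a then u else if k == b then v else p k].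
Proof.
apply/matrixP => x y; rewrite mxE pauli_pair !qbit_loc2 pauliE.
rewrite [RHS](bigD1 a) //= [X in _ = _ * X](bigD1 b) /=; last by rewrite eq_sym.
rewrite !ffunE eqxx [b == a]eq_sym (negbTE neq_ab) eqxx mulrA; congr (_ * _).
by apply: eq_bigr => k /andP[/negbTE nka /negbTE nkb]; rewrite ffunE nka nkb.
Qed.

Lemma mixed_scale c M p : mixed (c *: M) p = c *: mixed M p.
Proof. by apply/matrixP => x y; rewrite !mxE mulrA. Qed.

Lemma gate2_unitary M : unitary M -> unitary (gate2_mx a b M).
Proof.
rewrite /unitary => uM; rewrite gate2_mixed mixed_adj mixed_mul uM -[1%:M]pauli0.
have -> : (0 : pstr 2) = pair_string 0 0 by apply/ffunP => k; rewrite !ffunE if_same.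
rewrite mixed_pauli -pauli0; congr (pauli R _).
by apply/ffunP => k; rewrite !ffunE !if_same.
Qed.

(** Only the letters of p at a and b are touched. They form a two-qubit string, to which
    [clifford_adj] applies; the other letters are carried along. *)
Lemma gate2_conj_pauli M p : clifford2 M -> exists (c : C) q,
  adj (gate2_mx a b M) *m pauli R p *m gate2_mx a b M = c *: pauli R q.
Proof.
case=> uM cM; rewrite gate2_mixed mixed_adj.
have -> : pauli R p = mixed (pauli R (pair_string (p a) (p b))) p.
  rewrite mixed_pauli; congr (pauli R _); apply/ffunP => k; rewrite ffunE.
  by case: eqP => [->//|_]; case: eqP => [->|].
rewrite mixed_mul mixed_mulr.
have [c [q ->]] := @clifford_adj R 2 M uM cM (pair_string (p a) (p b)).
have -> : q = pair_string (q ord0) (q (lift ord0 ord0)).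
  apply/ffunP => k; rewrite ffunE; case: (unliftP ord0 k) => [j ->|->//].
  by rewrite [j]ord1.
by rewrite mixed_scale mixed_pauli; exists c; eexists.
Qed.

End TwoQubitGates.

Lemma dynamics_flat (R : realType) L (gs : seq (gate R L)) :
  valid_gates gs -> pauli_flat (dynamics gs).
Proof.
(* The accumulator of the fold is generalized from the identity to any flat matrix. *)
rewrite /dynamics; move: 1%:M (@pauli_flat1 R L) => M.
elim: gs M => [|g gs IHgs] M fM //= [vg vgs]; apply: IHgs => //.
case: g vg => [a b U [neq_ab cU]|k o _] /=; last exact: pauli_flat_meas.
apply: pauli_flat_unitary => //; first by apply: gate2_unitary => //; case: cU.
by move=> p; apply: gate2_conj_pauli.
Qed.

(** * Entropy of stabilizer states *)

(** Every eigenvalue z satisfies z^2 = l z, so it is 0 or l. On both, [eta2] takes the value -z log2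
    l (at 0 by its convention), and the trace makes the z sum to 1. *)
Lemma vn_entropy_flat (R : realType) m (M : 'M[R[i]]_m) (l : R) :
  0 < l -> \tr M = 1 -> M *m M = l%:C%C *: M -> vn_entropy M = - (ln l / ln 2).
Proof.
move=> l0 trM MM; rewrite /vn_entropy /eigenvalues.
case: closed_field_poly_normal => /= rs; rewrite (eqP (char_poly_monic M)) scale1r => defp.
have m0 : (0 < m)%N.
  by rewrite lt0n; apply/eqP => m0; move: trM; subst m; rewrite /mxtrace big_ord0 => /eqP;
    rewrite eq_sym oner_eq0.
have size_rs : size rs = m.
  by apply: succn_inj; rewrite -(size_char_poly M) defp size_prod_XsubC.
have sum_rs : \sum_(z <- rs) z = 1.
  apply: oppr_inj; rewrite -trM -(char_poly_trace _ m0) defp -size_rs coefPn_prod_XsubC //.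
  by rewrite size_rs -lt0n.
have rs_val z : z \in rs -> z = 0 \/ z = l%:C%C.
  rewrite -root_prod_XsubC -defp -eigenvalue_root_char => /eigenvalueP[v vM v0].
  have : (z * z) *: v = (l%:C%C * z) *: v.
    by rewrite -scalerA -vM scalemxAl -vM -mulmxA MM -scalemxAr vM scalerA.
  move/eqP; rewrite -subr_eq0 -scalerBl scaler_eq0 (negbTE v0) orbF -mulrBl mulf_eq0 subr_eq0.
  by case/orP => /eqP; [right|left].
rewrite (eq_big_seq (fun z => - (ln l / ln 2) * complex.Re z)) => [|z /rs_val[]->].
- rewrite -mulr_sumr -[RHS]mulr1; congr (_ * _).
  have -> : \sum_(z <- rs) complex.Re z = complex.Re (\sum_(z <- rs) z).
    by apply/esym/(big_morph (fun z : R[i] => complex.Re z)) => // -[? ?] [? ?].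
  by rewrite sum_rs.
- by rewrite /eta2 /= eqxx mulr0.
- by rewrite /eta2 /= (negbTE (lt0r_neq0 l0)) mulNr [_ * l]mulrC mulrA.
Qed.

Section Entropy.
Variable R : realType.
Local Notation C := R[i].
Local Notation sig u := (pauli1_mx R (pauli_of u)).
Variables (n : nat) (psi : nat -> C).
Local Notation N := (\sum_(z < 2 ^ n) psi z * conjc (psi z)).
Implicit Types p q : pstr n.

Definition state_col : 'cV[C]_(2 ^ n) := \col_x psi x.
Local Notation v := state_col.

Definition expect p : C :=
  (\sum_(a < 2 ^ n) \sum_(b < 2 ^ n) conjc (psi a) * pauli R p a b * psi b) / N.

Hypothesis N0 : N != 0.
Hypothesis stab : forall p, (exists c, pauli R p *m v = c *: v) \/ expect p = 0.

Lemma state_col_neq0 : v != 0.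
Proof.
apply: contraNneq N0 => v0; rewrite big1 // => z _.
by have /matrixP/(_ z ord0) := v0; rewrite !mxE => ->; rewrite mul0r.
Qed.

Lemma expect_eigen p c : pauli R p *m v = c *: v -> expect p = c.
Proof.
move=> pv; rewrite /expect; apply: (canLR (mulfK N0)).
rewrite mulr_sumr; apply: eq_bigr => a _.
have /matrixP/(_ a ord0) := pv; rewrite !mxE => cv.
under eq_bigr => b _ do rewrite -mulrA.
rewrite -mulr_sumr mulrA -cv mulrC; congr (_ * _).
by apply: eq_bigr => b _; rewrite !mxE.
Qed.

Lemma pauli_eigen p : expect p != 0 -> pauli R p *m v = expect p *: v.
Proof.
move=> ep0; case: (stab p) => [[c pv]|e0]; last by rewrite e0 eqxx in ep0.
by rewrite (expect_eigen pv).
Qed.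

Lemma expect0 : expect 0 = 1.
Proof. by apply: expect_eigen; rewrite pauli0 mul1mx scale1r. Qed.

Lemma expect_sqr p : expect p != 0 -> expect p * expect p = 1.
Proof.
move=> /pauli_eigen pv; apply/eqP; rewrite -subr_eq0.
have : (expect p * expect p - 1) *: v == 0.
  rewrite scalerBl scale1r -scalerA -pv scalemxAr -pv mulmxA pauli_sqr mul1mx subrr //.
by rewrite scaler_eq0 (negbTE state_col_neq0) orbF.
Qed.

Lemma expectD p q : expect p != 0 -> expect q != 0 ->
  expect p * expect q = phase R p q * expect (p + q).
Proof.
move=> /pauli_eigen pv /pauli_eigen qv.
have : pauli R (p + q) *m v = (phase R p q)^-1 * (expect p * expect q) *: v.
  apply: (scalerI (phase_neq0 R p q)).
  rewrite scalemxAl -pauli_mul -mulmxA qv -scalemxAr pv !scalerA.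
  by rewrite mulVKf ?phase_neq0 // mulrC.
by move/expect_eigen->; rewrite mulVKf ?phase_neq0.
Qed.

Lemma expectD_neq0 p q : expect p != 0 -> expect q != 0 -> expect (p + q) != 0.
Proof.
move=> p0 q0; have := mulf_neq0 p0 q0; rewrite expectD // mulf_eq0.
by rewrite negb_or => /andP[].
Qed.

(** The signed stabilizers are closed under multiplication: the phase w is a sign, because w times
    one expectation is a product of two others and all of them square to 1. *)
Lemma stab_mul p q : expect p != 0 -> expect q != 0 ->
  (expect p *: pauli R p) *m (expect q *: pauli R q) = expect (p + q) *: pauli R (p + q).
Proof.
move=> p0 q0; have pq0 := expectD_neq0 p0 q0.
rewrite -scalemxAl -scalemxAr scalerA pauli_mul scalerA; congr (_ *: _).
set w := phase R p q; have eq1 : expect p * expect q = w * expect (p + q) by exact: expectD.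
have ww : w * w = 1.
  have : (expect p * expect q) * (expect p * expect q) = 1.
    by rewrite mulrACA !expect_sqr // mulr1.
  by rewrite eq1 mulrACA expect_sqr // mulr1.
by rewrite eq1 mulrAC ww mul1r.
Qed.

(** * The reduced density matrix as a sum over stabilizers *)

Variable X : {set 'I_n}.

Definition stab_set : {set pstr n} := [set p | supported X p && (expect p != 0)].

(** This is the reduced density matrix tensored with the identity off X, whereas [reduced_rho] is
    padded by zeros there. *)
Definition kernel_mx : 'M[C]_(2 ^ n) :=
  (2 ^ #|X|)%:R^-1 *: \sum_(p in stab_set) expect p *: pauli R p.

(** Multiplication by a signed stabilizer permutes the signed stabilizers, so their sum S satisfies
    S^2 = |G_X| S. *)
Lemma kernel_mx_sqr :
  kernel_mx *m kernel_mx = (#|stab_set|%:R / (2 ^ #|X|)%:R) *: kernel_mx.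
Proof.
rewrite /kernel_mx; set S := \sum_(p in _) _.
suff SS : S *m S = #|stab_set|%:R *: S.
  by rewrite -scalemxAl -scalemxAr SS !scalerA; congr (_ *: _); rewrite mulrC mulrA.
rewrite {1}/S mulmx_suml {}/S.
rewrite scaler_nat -sumr_const; apply: eq_bigr => p; rewrite inE => /andP[sp p0].
rewrite mulmx_sumr [RHS](reindex_inj (addrI p)) /=.
apply: eq_big => q; last by rewrite inE => /andP[_ q0]; rewrite stab_mul.
rewrite !inE; apply/andP/andP => -[sq q0].
  by rewrite supportedD // expectD_neq0.
have -> : q = p + (p + q) by rewrite addrA pstr_addpp add0r.
by rewrite supportedD // expectD_neq0.
Qed.

Lemma kernel_mxE x y : kernel_mx x y =
  (2 ^ #|X|)%:R^-1 * \sum_(p | supported X p) expect p * pauli R p x y.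
Proof.
rewrite mxE summxE; congr (_ * _); rewrite [RHS](bigID (fun p => expect p == 0)) /=.
rewrite [X in _ = X + _]big1 ?add0r => [|p /andP[_ /eqP->]]; last by rewrite mul0r.
by apply: eq_big => p; rewrite ?inE // mxE.
Qed.

(** On X the swaps force a = y and b = x; elsewhere b = a. Thus a and x determine b. *)
Lemma swap_delta (a b x y : 'I_(2 ^ n)) :
    vanish_on (~: X) x -> vanish_on (~: X) y ->
  \sum_(p | supported X p) pauli R p a b * pauli R p x y =
  if [forall k in X, qbit a k == qbit y k] &&
     (b == of_bits [ffun k => if k \in X then qbit x k else qbit a k])
  then (2 ^ #|X|)%:R else 0.
Proof.
move=> /forall_inP vx /forall_inP vy.
have xy0 k : k \notin X -> qbit x k = qbit y k.
  by move=> nXk; rewrite (negbTE (vx k _)) ?(negbTE (vy k _)) // inE.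
rewrite pauli_swap; case: ifP => [/andP[/forall_inP eqay /eqP ->]|/negbT].
  transitivity (\prod_(k in X) (2 : C)); last by rewrite prodr_const natrX.
  rewrite [RHS]big_mkcond; apply: eq_bigr => k _; rewrite of_bitsE ffunE.
  case: (boolP (k \in X)) => Xk; first by rewrite (eqP (eqay k Xk)) !eqxx.
  by rewrite eqxx xy0 ?eqxx.
rewrite negb_and => /orP[|neqb].
  rewrite negb_forall => /existsP[k]; rewrite negb_imply => /andP[Xk neq].
  by rewrite (bigD1 k) //= Xk (negbTE neq) mul0r.
set f := finfun _ in neqb.
have [k neqk|eqb] := pickP (fun k : 'I_n => qbit b k != f k).
  rewrite (bigD1 k) //=; move: neqk; rewrite ffunE; case: (boolP (k \in X)) => Xk neqk.
    by rewrite (negbTE neqk) andbF mul0r.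
  by rewrite eq_sym (negbTE neqk) mul0r.
case/eqP: neqb; apply: qbit_inj => k; rewrite of_bitsE; apply/eqP; exact/negbFE/eqb.
Qed.

(** With each expectation written as a double sum over basis states a and b, the inner sum over
    strings is [swap_delta]. What survives is the partial trace. *)
Lemma reduced_rho_kernel x y : reduced_rho psi X x y =
  if vanish_on (~: X) x && vanish_on (~: X) y then kernel_mx x y else 0.
Proof.
rewrite mxE; case: ifP => // /andP[vx vy]; rewrite kernel_mxE.
have c0 : (2 ^ #|X|)%:R != 0 :> C by rewrite pnatr_eq0 expn_eq0.
apply: (canRL (mulKf c0)); rewrite mulrA.
under [RHS]eq_bigr => p _ do rewrite mulrAC.
rewrite -mulr_suml; congr (_ / _).
transitivity (\sum_(a < 2 ^ n) \sum_(b < 2 ^ n) conjc (psi a) * psi b *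
    \sum_(p | supported X p) pauli R p a b * pauli R p x y); last first.
  under [RHS]eq_bigr => p _ do rewrite mulr_suml.
  rewrite [RHS]exchange_big; apply: eq_bigr => a _.
  under [RHS]eq_bigr => p _ do rewrite mulr_suml.
  rewrite [RHS]exchange_big; apply: eq_bigr => b _.
  by rewrite mulr_sumr; apply: eq_bigr => p _; rewrite mulrA; congr (_ * _); rewrite mulrAC.
(* The only b that survives for a given a: x on X and a elsewhere. *)
pose mix (a : 'I_(2 ^ n)) := of_bits [ffun k => if k \in X then qbit x k else qbit a k].
transitivity (\sum_(a < 2 ^ n | [forall k in X, qbit a k == qbit y k])
    (2 ^ #|X|)%:R * (psi (mix a) * conjc (psi a))); last first.
  rewrite big_mkcond; apply: eq_bigr => a _; rewrite (bigD1 (mix a)) //= swap_delta // eqxx andbT.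
  rewrite [X in _ = _ + X]big1 ?addr0 => [|b neq]; last by rewrite swap_delta // (negbTE neq) andbF mulr0.
  by case: ifP => _; rewrite ?mulr0 // mulrC [psi _ * _]mulrC.
rewrite mulr_sumr.
(* An a equal to y on X is [y + e] with e vanishing on X; [h] and [h'] translate between a and e. *)
pose h (e : 'I_(2 ^ n)) := of_bits [ffun k => if k \in X then qbit y k else qbit e k].
pose h' (a : 'I_(2 ^ n)) := of_bits [ffun k => (k \notin X) && qbit a k].
rewrite [RHS](reindex_onto h h') /= => [|a /forall_inP eqay]; last first.
  apply: qbit_inj => k; rewrite !of_bitsE !ffunE; rewrite of_bitsE ffunE.
  by case: (boolP (k \in X)) => Xk //=; rewrite (eqP (eqay k Xk)).
have /forall_inP vx' := vx; have /forall_inP vy' := vy.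
apply: eq_big => e.
  have -> : [forall k in X, qbit (h e) k == qbit y k].
    by apply/forall_inP => k Xk; rewrite of_bitsE ffunE Xk.
  apply/forall_inP/eqP => [ve|<- k Xk]; last by rewrite of_bitsE ffunE Xk.
  apply: qbit_inj => k; rewrite !of_bitsE !ffunE !of_bitsE ffunE.
  by case: (boolP (k \in X)) => Xk //=; rewrite (negbTE (ve k Xk)).
move=> /forall_inP ve; congr (_ * (psi _ * conjc (psi _))).
  rewrite addn_disjoint => [|k]; last first.
    by case: (boolP (k \in X)) => Xk; rewrite ?(negbTE (ve k Xk)) ?andbF // (negbTE (vx' k _)) // inE.
  congr (nat_of_ord (of_bits _)); apply/ffunP => k; rewrite !ffunE of_bitsE ffunE.
  by case: (boolP (k \in X)) => Xk; rewrite ?(negbTE (ve k Xk)) ?orbF // (negbTE (vx' k _)) // inE.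
rewrite addn_disjoint => [|k]; last first.
  by case: (boolP (k \in X)) => Xk; rewrite ?(negbTE (ve k Xk)) ?andbF // (negbTE (vy' k _)) // inE.
congr (nat_of_ord (of_bits _)); apply/ffunP => k; rewrite !ffunE.
by case: (boolP (k \in X)) => Xk; rewrite ?(negbTE (ve k Xk)) ?orbF // (negbTE (vy' k _)) // inE.
Qed.

(** Strings supported on X are diagonal outside X. Hence the intermediate sum in the square of
    [reduced_rho] may run over all y. *)
Lemma kernel_mx_block (x y : 'I_(2 ^ n)) :
  vanish_on (~: X) x -> ~~ vanish_on (~: X) y -> kernel_mx x y = 0.
Proof.
move=> /forall_inP vx; rewrite negb_forall => /existsP[k]; rewrite negb_imply negbK.
case/andP=> nXk yk; rewrite kernel_mxE big1 ?mulr0 // => p /supportedP sp.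
rewrite pauliE (bigD1 k) //= sp /=; last by rewrite inE in nXk.
by rewrite (negbTE (vx k nXk)) yk mul0r mulr0.
Qed.

Lemma reduced_rho_sqr : reduced_rho psi X *m reduced_rho psi X =
  (#|stab_set|%:R / (2 ^ #|X|)%:R) *: reduced_rho psi X.
Proof.
apply/matrixP => x z; rewrite [RHS]mxE [LHS]mxE reduced_rho_kernel.
under eq_bigr => y _ do rewrite !reduced_rho_kernel.
case: (boolP (vanish_on (~: X) x)) => vx; last by rewrite /= mulr0 big1 // => y _; rewrite mul0r.
case: (boolP (vanish_on (~: X) z)) => vz; last by rewrite /= mulr0 big1 // => y _; rewrite andbF mulr0.
have /matrixP/(_ x z) := kernel_mx_sqr; rewrite [LHS]mxE [RHS]mxE => <-.
apply: eq_bigr => y _; rewrite andbT.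
by case: (boolP (vanish_on (~: X) y)) => //= vy; rewrite kernel_mx_block // !mul0r.
Qed.

Lemma vanish_onE (S : {set 'I_n}) (x : nat) :
  (vanish_on S x)%:R = \prod_(k < n) ((k \notin S) || ~~ qbit x k)%:R :> C.
Proof.
case: (boolP (vanish_on S x)) => [/forall_inP v0|].
  by rewrite big1 // => k _; case: (boolP (k \in S)) => //= /v0 ->.
rewrite negb_forall => /existsP[k]; rewrite negb_imply negbK => /andP[Sk xk].
by rewrite (bigD1 k) //= Sk xk mul0r.
Qed.

(** Only the identity string contributes to the trace over the block: any other supported string has
    a traceless letter at some site of X. *)
Lemma reduced_rho_trace : \tr (reduced_rho psi X) = 1.
Proof.
have c0 : (2 ^ #|X|)%:R != 0 :> C by rewrite pnatr_eq0 expn_eq0.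
pose t p : C := \sum_(x < 2 ^ n) (vanish_on (~: X) x)%:R * pauli R p x x.
have tE p : t p = \prod_(k < n) \sum_b ((k \in X) || ~~ b)%:R * sig (p k) b b.
  rewrite -(prod_sum_qbit (fun k b => ((k \in X) || ~~ b)%:R * sig (p k) b b)).
  apply: eq_bigr => x _; rewrite vanish_onE pauliE -big_split /=.
  by apply: eq_bigr => k _; rewrite inE negbK.
transitivity ((2 ^ #|X|)%:R^-1 * \sum_(p | supported X p) expect p * t p).
  rewrite /mxtrace; under eq_bigr => x _ do rewrite reduced_rho_kernel andbb kernel_mxE.
  under [in RHS]eq_bigr => p _ do rewrite mulr_sumr.
  rewrite exchange_big mulr_sumr; apply: eq_bigr => x _ /=.
  case: ifP => _; last by rewrite big1 ?mulr0 // => p _; rewrite mul0r mulr0.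
  by congr (_ * _); apply: eq_bigr => p _; rewrite mul1r.
rewrite (bigD1 0) ?supported0 //= expect0 mul1r [X in _ + X]big1 ?addr0.
  rewrite tE (eq_bigr (fun k => if k \in X then 2 else 1)) => [|k _].
    by rewrite -big_mkcond prodr_const natrX mulVf // -natrX.
  by rewrite big_bool ffunE /=; case: (k \in X); rewrite /= ?mul1r ?mul0r ?add0r.
move=> p /andP[/supportedP sp p0].
have [k pk|eqp] := pickP (fun k : 'I_n => p k != 0); last first.
  by case/eqP: p0; apply/ffunP => k; rewrite ffunE; apply/eqP; exact/negbFE/eqp.
have Xk : k \in X by apply: contraNT pk => /sp ->.
rewrite tE (bigD1 k) //= Xk.
under eq_bigr => b _ do rewrite mul1r.
by rewrite pauli1_trace (negbTE pk) mul0r mulr0.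
Qed.

Lemma entropy_stab :
  vn_entropy (reduced_rho psi X) = #|X|%:R - ln #|stab_set|%:R / ln 2.
Proof.
have G0 : (0 < #|stab_set|)%N.
  by apply/card_gt0P; exists 0; rewrite inE supported0 expect0 oner_eq0.
have l2 : ln 2 != 0 :> R by apply: lt0r_neq0; apply: ln_gt0; rewrite ltr1n.
rewrite (@vn_entropy_flat _ _ _ (#|stab_set|%:R / (2 ^ #|X|)%:R)).
- rewrite ln_div ?posrE ?ltr0n ?expn_gt0 // natrX lnXn ?ltr0n // mulrBl opprB.
  by rewrite -[ln 2 *+ _]mulr_natl mulfK.
- by rewrite divr_gt0 ?ltr0n ?expn_gt0.
- exact: reduced_rho_trace.
- by rewrite reduced_rho_sqr rmorphM fmorphV !rmorph_nat.
Qed.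

End Entropy.

(** * Transferred logical operators *)

(** To be read with a = |A|, b = |B|, l = ln 2, and with t, g and n * l + t + g the logarithms of
    the numbers of stabilizers on the A side, on the B side and on both. *)
Lemma entropy_balance (F : fieldType) (a b l n t g : F) : l != 0 ->
  a - t / l + (b - g / l) - (a + b - (n * l + t + g) / l) = n.
Proof. by move=> l0; field. Qed.

Section Transfer.
Variable R : realType.
Local Notation C := R[i].
Variables (L : nat) (M : 'M[C]_(2 ^ L)).
Implicit Types (p q : pstr L) (A B : {set 'I_L}).

Lemma pack_subproof (i j : 'I_(2 ^ L)) : (i + 2 ^ L * j < 2 ^ (L + L))%N.
Proof.
apply: (@leq_trans (2 ^ L * j.+1)); first by rewrite mulnS ltn_add2r.
by rewrite expnD leq_pmul2l ?expn_gt0.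
Qed.

Definition pack (ij : 'I_(2 ^ L) * 'I_(2 ^ L)) : 'I_(2 ^ (L + L)) :=
  Ordinal (pack_subproof ij.1 ij.2).

Lemma qbit_pack ij (k : 'I_L) :
  (qbit (pack ij) (lshift L k) = qbit ij.1 k) * (qbit (pack ij) (rshift L k) = qbit ij.2 k).
Proof. by split; rewrite qbit_split //= ?ltn_ord // ltnNge leq_addr /= addKn. Qed.

Lemma pack_inj : injective pack.
Proof.
move=> [i j] [i' j'] eq_ij; congr (_, _); apply: qbit_inj => k.
  by rewrite -[LHS](qbit_pack (i, j) k).1 eq_ij qbit_pack.
by rewrite -[LHS](qbit_pack (i, j) k).2 eq_ij qbit_pack.
Qed.

Lemma pack_bij : bijective pack.
Proof. by apply: (inj_card_bij pack_inj); rewrite card_prod !card_ord expnD. Qed.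

Lemma sum_pack (V : nmodType) (F : 'I_(2 ^ (L + L)) -> V) :
  \sum_x F x = \sum_i \sum_j F (pack (i, j)).
Proof.
rewrite pair_bigA (reindex pack) /=; first by apply: eq_bigr => -[].
exact/onW_bij/pack_bij.
Qed.

Lemma phi_amp_pack i j : phi_amp M (pack (i, j)) = M i j.
Proof.
rewrite /phi_amp (bigD1 i) //= (bigD1 j) //= eqxx big1 ?addr0 => [|j' neq].
  rewrite big1 ?addr0 // => i' neq; rewrite big1 // => j' _; case: eqP => // eq_ij.
  have /pack_inj[eqi _] : pack (i, j) = pack (i', j') by apply: val_inj.
  by rewrite eqi eqxx in neq.
case: eqP => // eq_ij; have /pack_inj[eqj] : pack (i, j) = pack (i, j') by apply: val_inj.
by rewrite eqj eqxx in neq.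
Qed.

Definition merge q p : pstr (L + L) :=
  [ffun k => match split k with inl k' => q k' | inr k' => p k' end].

Lemma mergeE q p k : (merge q p (lshift L k) = q k) * (merge q p (rshift L k) = p k).
Proof.
by rewrite !ffunE (unsplitK (inl k)) (unsplitK (inr k)).
Qed.

Lemma merge_surj (g : pstr (L + L)) :
  g = merge [ffun k => g (lshift L k)] [ffun k => g (rshift L k)].
Proof.
by apply/ffunP => k; rewrite ffunE -{1}(splitK k); case: (split k) => k' /=; rewrite ffunE.
Qed.

Lemma pauli_merge q p i j i' j' :
  pauli R (merge q p) (pack (i, j)) (pack (i', j')) = pauli R q i i' * pauli R p j j'.
Proof.
rewrite !pauliE big_split_ord; congr (_ * _); apply: eq_bigr => k _.
  by rewrite !mergeE !qbit_pack.
by rewrite !mergeE !qbit_pack.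
Qed.

(** Vectorization: q acting on P and p acting on R turn the state of M into that of q M p^T, and p^T
    is p up to sign. *)
Lemma pauli_merge_state q p i j :
  (pauli R (merge q p) *m state_col (L + L) (phi_amp M)) (pack (i, j)) ord0 =
  transpose_sign R p * (pauli R q *m M *m pauli R p) i j.
Proof.
have -> : transpose_sign R p * (pauli R q *m M *m pauli R p) i j =
    (pauli R q *m M *m (pauli R p)^T) i j.
  by rewrite pauli_transpose -scalemxAr [RHS]mxE.
rewrite mxE sum_pack exchange_big mxE /=; apply: eq_bigr => j' _.
rewrite mxE mulr_suml; apply: eq_bigr => i' _.
by rewrite pauli_merge [state_col _ _ _ _]mxE phi_amp_pack [(_^T) _ _]mxE mulrAC.
Qed.

(** Up to sign and normalization, the expectation of [merge q p] in the state of M; for flat nonzero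
    M it is nonzero exactly on stabilizers. *)
Definition expectM q p : C := \tr (adj M *m (pauli R q *m M *m pauli R p)).

Lemma norm_phi_amp :
  \sum_(z < 2 ^ (L + L)) phi_amp M z * conjc (phi_amp M z) = \tr (adj M *m M).
Proof.
rewrite trace_adj_mul sum_pack; apply: eq_bigr => i _; apply: eq_bigr => j _.
by rewrite phi_amp_pack.
Qed.

Lemma expect_merge q p : expect (phi_amp M) (merge q p) =
  transpose_sign R p * expectM q p / \tr (adj M *m M).
Proof.
rewrite /expect norm_phi_amp; congr (_ / _).
rewrite sum_pack /expectM /mxtrace exchange_big /= mulr_sumr; apply: eq_bigr => j _.
rewrite [X in _ * X]mxE mulr_sumr; apply: eq_bigr => i _.
rewrite [adj M _ _]mxE mulrCA -pauli_merge_state [X in _ * X]mxE mulr_sumr.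
by apply: eq_bigr => x _; rewrite phi_amp_pack [state_col _ _ _ _]mxE mulrA.
Qed.

Hypothesis M0 : M != 0.
Hypothesis flatM : pauli_flat M.

Let N0 : \tr (adj M *m M) != 0.
Proof. by rewrite trace_adj_mul_eq0. Qed.

Lemma expect_merge_neq0 q p : (expect (phi_amp M) (merge q p) != 0) = (expectM q p != 0).
Proof.
by rewrite expect_merge !mulf_eq0 invr_eq0 (negbTE N0) orbF (negbTE (transpose_sign_neq0 R p)).
Qed.

Lemma state_stab (g : pstr (L + L)) :
  (exists c, pauli R g *m state_col (L + L) (phi_amp M) = c *: state_col (L + L) (phi_amp M)) \/
  expect (phi_amp M) g = 0.
Proof.
rewrite (merge_surj g); set q := finfun _; set p := finfun _.
have [[c qMp]|tr0] := flatM q p; last first.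
  by right; rewrite expect_merge /expectM tr0 mulr0 mul0r.
left; exists (transpose_sign R p * c); apply/colP => x.
have [f _ fK] := pack_bij; rewrite -(fK x); case: (f x) => i j.
by rewrite pauli_merge_state qMp !mxE phi_amp_pack mulrA.
Qed.

Lemma expectM_neq0 q p (c : C) :
  c != 0 -> pauli R q *m M *m pauli R p = c *: M -> expectM q p != 0.
Proof. by move=> c0 eqM; rewrite /expectM eqM -scalemxAr mxtraceZ mulf_neq0. Qed.

(** Flatness leaves only q M p = c M; applying both strings once more gives c^2 = 1. *)
Lemma expectM_stab q p : expectM q p != 0 ->
  exists2 c : C, c * c = 1 & pauli R q *m M *m pauli R p = c *: M.
Proof.
case: (flatM q p) => [[c eqM] _|tr0]; last by rewrite /expectM tr0 eqxx.
exists c => //; apply/eqP; rewrite -subr_eq0.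
have : (c * c - 1) *: M == 0.
  rewrite scalerBl scale1r -scalerA -eqM scalemxAl scalemxAr -eqM !mulmxA pauli_sqr mul1mx.
  by rewrite -mulmxA pauli_sqr mulmx1 subrr.
by rewrite scaler_eq0 (negbTE M0) orbF.
Qed.

Lemma expectM0 : expectM 0 0 != 0.
Proof. by apply: (@expectM_neq0 _ _ 1); rewrite ?oner_eq0 // pauli0 mul1mx mulmx1 scale1r. Qed.

Lemma expectMD q q' p p' :
  expectM q p != 0 -> expectM q' p' != 0 -> expectM (q + q') (p + p') != 0.
Proof.
move=> /expectM_stab[c cc eqM] /expectM_stab[c' cc' eqM'].
(* The two phases convert products of strings into strings of sums; on the right of M the factors
   compose in reverse order, hence [phase R p' p]. *)
apply: (@expectM_neq0 _ _ ((phase R q q')^-1 * (phase R p' p)^-1 * (c * c'))).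
  have neq0 (z : C) : z * z = 1 -> z != 0.
    by move=> zz; apply: contra_eq_neq zz => ->; rewrite mul0r eq_sym oner_eq0.
  by rewrite !mulf_neq0 ?invr_eq0 ?phase_neq0 ?neq0.
have -> : pauli R (q + q') = (phase R q q')^-1 *: (pauli R q *m pauli R q').
  by rewrite pauli_mul scalerK // phase_neq0.
have -> : pauli R (p + p') = (phase R p' p)^-1 *: (pauli R p' *m pauli R p).
  by rewrite pauli_mul scalerK ?phase_neq0 // addrC.
rewrite -!scalemxAl -scalemxAr !scalerA -[RHS]scalerA; congr (_ *: _).
rewrite mulmxA -(mulmxA (pauli R q)) -(mulmxA (pauli R q)) eqM' -scalemxAr -scalemxAl eqM.
by rewrite scalerA mulrC.
Qed.

(** * Counting stabilizers across the two sides *)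

Definition stab_pairs A B : {set pstr L * pstr L} :=
  [set qp | [&& supported B qp.1, supported A qp.2 & expectM qp.1 qp.2 != 0]].

Lemma supported_merge A B q p :
  supported (R_sites A :|: P_sites B) (merge q p) = supported B q && supported A p.
Proof.
have inL k : (lshift L k \in R_sites A :|: P_sites B) = (k \in B).
  rewrite inE (mem_imset _ _ (@lshift_inj L L)).
  suff -> : (lshift L k \in R_sites A) = false by [].
  by apply/imsetP => -[j _] /eqP; rewrite eq_lrshift.
have inR k : (rshift L k \in R_sites A :|: P_sites B) = (k \in A).
  rewrite inE (mem_imset _ _ (@rshift_inj L L)).
  suff -> : (rshift L k \in P_sites B) = false by rewrite orbF.
  by apply/imsetP => -[j _] /eqP; rewrite eq_rlshift.
apply/supportedP/andP => [s|[/supportedP sq /supportedP sp] k].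
  split; apply/supportedP => k nk.
    by have := s (lshift L k); rewrite inL mergeE => ->.
  by have := s (rshift L k); rewrite inR mergeE => ->.
rewrite -(splitK k); case: (split k) => k' /=; rewrite ?inL ?inR mergeE.
  exact: sq.
exact: sp.
Qed.

Lemma entropy_sites A B :
  vn_entropy (reduced_rho (phi_amp M) (R_sites A :|: P_sites B)) =
  (#|A| + #|B|)%:R - ln #|stab_pairs A B|%:R / ln 2.
Proof.
rewrite entropy_stab ?norm_phi_amp //; last exact: state_stab.
congr (_%:R - ln _%:R / _).
  rewrite cardsU (_ : _ :&: _ = set0) ?cards0 ?subn0; last first.
    apply/setP => k; rewrite !inE; apply/negP => /andP[/imsetP[j _ ->] /imsetP[j' _ /eqP]].
    by rewrite eq_rlshift.
  by rewrite !card_imset //; [exact: lshift_inj|exact: rshift_inj].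
have merge_inj : injective (fun qp : pstr L * pstr L => merge qp.1 qp.2).
  move=> [q p] [q' p'] /= /ffunP eq_qp; congr (_, _); apply/ffunP => k.
    by have := eq_qp (lshift L k); rewrite !mergeE.
  by have := eq_qp (rshift L k); rewrite !mergeE.
rewrite -(card_imset _ merge_inj); apply: eq_card => g; rewrite inE.
apply/idP/imsetP => [|[[q p]]]; last first.
  by rewrite inE /= => /and3P[sq sp e] ->; rewrite supported_merge sq sp expect_merge_neq0.
rewrite (merge_surj g); set q := finfun _; set p := finfun _.
rewrite supported_merge expect_merge_neq0 -andbA => qp.
by exists (q, p); rewrite ?inE.
Qed.

(** The group H: as q^2 = 1, the relation q M p = c M with c nonzero says that M p is a multiple of
    q M, so p is transferred to q up to a scalar. *)
Definition transferable A B : {set pstr L} :=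
  [set p | supported A p && [exists q, supported B q && (expectM q p != 0)]].

Definition trivial_on A : {set pstr L} := [set p | supported A p && (expectM 0 p != 0)].

Definition output_stab B : {set pstr L} := [set q | supported B q && (expectM q 0 != 0)].

Lemma supported_set0 p : supported set0 p = (p == 0).
Proof.
apply/supportedP/eqP => [s|-> k _]; last by rewrite ffunE.
by apply/ffunP => k; rewrite s ?inE // ffunE.
Qed.

(** With one of the two sets empty, [entropy_sites] also gives the entropy of a single side. *)
Lemma card_stab_pairs0r A : #|stab_pairs A set0| = #|trivial_on A|.
Proof.
have inj0 : injective (fun p : pstr L => (0 : pstr L, p)) by move=> p p' [].
rewrite -[RHS](card_imset _ inj0); apply: eq_card => -[q p]; rewrite !inE supported_set0 /=.
apply/and3P/imsetP => [[/eqP-> sp e]|[p']]; first by exists p; rewrite ?inE ?sp.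
by rewrite inE => /andP[sp e] [-> ->].
Qed.

Lemma card_stab_pairs0l B : #|stab_pairs set0 B| = #|output_stab B|.
Proof.
have inj0 : injective (fun q : pstr L => (q, 0 : pstr L)) by move=> q q' [].
rewrite -[RHS](card_imset _ inj0); apply: eq_card => -[q p]; rewrite !inE supported_set0 /=.
apply/and3P/imsetP => [[sq /eqP-> e]|[q']]; first by exists q; rewrite ?inE ?sq.
by rewrite inE => /andP[sq e] [-> ->].
Qed.

(** Once a transfer [q0 p] is fixed for every transferable p, the pairs over p are [q0 p] shifted by
    the elements of [output_stab B]. *)
Lemma card_stab_pairs A B :
  #|stab_pairs A B| = (#|transferable A B| * #|output_stab B|)%N.
Proof.
pose q0 p := odflt 0 [pick q | supported B q && (expectM q p != 0)].
have q0P p : p \in transferable A B -> supported B (q0 p) /\ expectM (q0 p) p != 0.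
  rewrite inE /q0 => /andP[_ /existsP[q qP]].
  by case: pickP => [q' /andP[]|/(_ q)] //; rewrite qP.
pose f (pq : pstr L * pstr L) := (q0 pq.1 + pq.2, pq.1).
have f_inj : injective f by move=> [p q] [p' q'] [eq1 eq2]; move: eq1; rewrite /= eq2 => /addrI->.
rewrite -cardsX -[RHS](card_imset _ f_inj); apply: eq_card => -[q p]; rewrite !inE /=.
apply/and3P/imsetP => [[sq sp e]|[[p' q']]]; last first.
  rewrite !inE /= => /andP[Hp /andP[sq' e']] [-> ->].
  have [sq0 e0] : supported B (q0 p') /\ expectM (q0 p') p' != 0 by apply: q0P; rewrite inE.
  by case/andP: Hp => -> _; rewrite (supportedD sq0 sq'); have := expectMD e0 e'; rewrite addr0 => ->.
have Hp : p \in transferable A B by rewrite inE sp; apply/existsP; exists q; rewrite sq.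
have [sq0 e0] := q0P p Hp.
exists (p, q0 p + q); last by rewrite /f /= addrA pstr_addpp add0r.
have := expectMD e0 e; rewrite pstr_addpp => e1.
by rewrite in_setX Hp inE (supportedD sq0 sq).
Qed.

Lemma mutual_info_card A B n :
    #|transferable A B| = (2 ^ n * #|trivial_on A|)%N ->
  mutual_info M A B = n%:R.
Proof.
move=> cardH; rewrite /mutual_info.
have T0 : (0 < #|trivial_on A|)%N.
  by apply/card_gt0P; exists 0; rewrite inE supported0 expectM0.
have G0 : (0 < #|output_stab B|)%N.
  by apply/card_gt0P; exists 0; rewrite inE supported0 expectM0.
have -> : R_sites A = R_sites A :|: P_sites set0 by rewrite /P_sites imset0 setU0.
have -> : P_sites B = R_sites set0 :|: P_sites B by rewrite /R_sites imset0 set0U.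
have -> : R_sites A :|: P_sites set0 :|: (R_sites set0 :|: P_sites B) = R_sites A :|: P_sites B.
  by rewrite /R_sites /P_sites !imset0 setU0 set0U.
rewrite !entropy_sites card_stab_pairs0r card_stab_pairs0l card_stab_pairs cardH !cards0.
have l2 : ln 2 != 0 :> R by apply: lt0r_neq0; apply: ln_gt0; rewrite ltr1n.
rewrite addn0 add0n !natrM natrX !lnM ?posrE ?mulr_gt0 ?exprn_gt0 ?ltr0n //.
rewrite lnXn ?ltr0n // -[ln 2 *+ n]mulr_natl natrD.
exact: entropy_balance.
Qed.

Lemma closed_transferable A B : closed_add (transferable A B).
Proof.
move=> p p'; rewrite !inE => /andP[sp /existsP[q /andP[sq e]]] /andP[sp' /existsP[q' /andP[sq' e']]].
rewrite (supportedD sp sp'); apply/existsP; exists (q + q').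
by rewrite (supportedD sq sq') (expectMD e e').
Qed.

Lemma closed_trivial_on A : closed_add (trivial_on A).
Proof.
move=> p p'; rewrite !inE => /andP[sp e] /andP[sp' e'].
by rewrite (supportedD sp sp'); have := expectMD e e'; rewrite addr0.
Qed.

Lemma trivial_on_sub A B : trivial_on A \subset transferable A B.
Proof.
apply/subsetP => p; rewrite !inE => /andP[-> e].
by apply/existsP; exists 0; rewrite supported0.
Qed.

Lemma trivial_on0 A : 0 \in trivial_on A.
Proof. by rewrite inE supported0 expectM0. Qed.

(** Forwards, tr (M^* M p) = c tr (M^* M), where c is nonzero because p is invertible. Backwards,
    the adjoint of M p = c M moves p to the left of M^* M. *)
Lemma trivial_logicalP p :
  (exists c : C, pauli R p *m P_in M = c *: P_in M) <-> expectM 0 p != 0.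
Proof.
split=> [[c eqP]|/expectM_stab[c _]].
  have : expectM 0 p = c * \tr (adj M *m M).
    rewrite /expectM pauli0 mul1mx mulmxA mxtrace_mulC -mxtraceZ; congr (\tr _).
    exact: eqP.
  move=> ->; apply: mulf_neq0 => //; apply: contraNneq N0 => c0.
  rewrite -[adj M *m M]mul1mx -(pauli_sqr R p) -mulmxA.
  by rewrite -/(P_in M) eqP c0 scale0r mulmx0 mxtrace0.
rewrite pauli0 mul1mx => eqM; exists (conjc c).
by rewrite /P_in mulmxA -[pauli R p]pauli_adj -adj_mulmx eqM adj_scalemx -scalemxAl.
Qed.

(** * From Pauli operators to strings and back *)

Lemma pauli_mxE n (c : C) (t : 'I_n -> pauli1) :
  pauli_mx c t = c *: pauli R ([ffun k => code_of (t k)] : pstr n).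
Proof.
apply/matrixP => x y; rewrite !mxE mul1r; congr (_ * _).
by apply: eq_bigr => k _; rewrite ffunE code_ofK.
Qed.

Lemma pauli_onP A (O : 'M[C]_(2 ^ L)) : pauli_on A O ->
  exists (c : C) (p : pstr L), [/\ c != 0, supported A p & O = c *: pauli R p].
Proof.
case=> c [t [c4 tI ->]]; exists c, [ffun k => code_of (t k)]; split.
- exact: exp4_neq0.
- by apply/supportedP => k nAk; rewrite ffunE tI.
- exact: pauli_mxE.
Qed.

Lemma pauli_on_pauli A (c : C) p : c ^+ 4 = 1 -> supported A p -> pauli_on A (c *: pauli R p).
Proof.
move=> c4 /supportedP sp; exists c, (fun k => pauli_of (p k)); split=> //.
  by move=> k nAk; rewrite sp.
by rewrite pauli_mxE; congr (_ *: pauli R _); apply/ffunP => k; rewrite ffunE; case: (p k) => -[] [].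
Qed.

Lemma prod_pauli k (O : 'I_k -> 'M[C]_(2 ^ L)) (c : 'I_k -> C) (p : 'I_k -> pstr L)
    (S : {set 'I_k}) :
    (forall i, c i != 0) -> (forall i, O i = c i *: pauli R (p i)) ->
  exists2 w : C, w != 0 &
    \big[@mulmx C _ _ _/1%:M]_(i in S) O i = w *: pauli R (\sum_(i in S) p i).
Proof.
move=> c0 defO; elim/big_rec2: _ => [|i s N _ [w w0 ->]].
  by exists 1; rewrite ?oner_eq0 // scale1r pauli0.
exists (c i * w * phase R (p i) s); first by rewrite !mulf_neq0 ?phase_neq0.
by rewrite defO -scalemxAl -scalemxAr pauli_mul !scalerA.
Qed.

(** A product of the operators is, up to a nonzero scalar, the string of the sum, so its triviality
    on the code space is membership in [trivial_on A]. *)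
Lemma independent_logicals A k (O : 'I_k -> 'M[C]_(2 ^ L)) (c : 'I_k -> C)
    (p : 'I_k -> pstr L) :
    (forall i, c i != 0) -> (forall i, O i = c i *: pauli R (p i)) ->
    (forall i, supported A (p i)) ->
  (forall S : {set 'I_k}, S != set0 ->
     ~ exists c : C, (\big[@mulmx C _ _ _/1%:M]_(i in S) O i) *m P_in M = c *: P_in M) <->
  independent_mod (trivial_on A) p.
Proof.
move=> c0 defO sp.
have sumA (S : {set 'I_k}) : supported A (\sum_(i in S) p i).
  by elim/big_rec: _ => [|i s _ ss]; rewrite ?supported0 ?supportedD.
have triv (S : {set 'I_k}) :
    (exists c : C, (\big[@mulmx C _ _ _/1%:M]_(i in S) O i) *m P_in M = c *: P_in M) <->
    \sum_(i in S) p i \in trivial_on A.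
  rewrite inE sumA /=; have [w w0 ->] := prod_pauli S c0 defO.
  rewrite -trivial_logicalP; split=> -[d].
    rewrite -scalemxAl => eqP; exists (w^-1 * d).
    by rewrite -scalerA -eqP scalerK.
  by move=> eqP; exists (w * d); rewrite -scalemxAl eqP scalerA.
split=> ind S S0; first by apply/negP => /triv; exact: ind.
by move/triv; apply/negP/ind.
Qed.

(** With [Ot] a multiple of a string q, multiplying M O = Ot M on the left by q makes (q, p) a
    stabilizing pair. *)
Lemma transfer_string A B (O : 'M[C]_(2 ^ L)) (c : C) p :
    c != 0 -> O = c *: pauli R p -> supported A p ->
    (exists Ot : 'M[C]_(2 ^ L), [/\ pauli_on B Ot, Ot *m P_out M = P_out M *m Ot &
                                 M *m O = Ot *m M]) ->
  p \in transferable A B.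
Proof.
move=> c0 defO sp [Ot [/pauli_onP[d [q [d0 sq ->]]] _ eqM]].
rewrite inE sp; apply/existsP; exists q; rewrite sq /=.
apply: (@expectM_neq0 _ _ (c^-1 * d)); first by rewrite mulf_neq0 ?invr_eq0.
have -> : pauli R q *m M *m pauli R p = c^-1 *: (pauli R q *m (M *m O)).
  by rewrite defO -!scalemxAr scalerK // mulmxA.
by rewrite eqM -scalemxAl -scalemxAr mulmxA pauli_sqr mul1mx scalerA.
Qed.

(** The output operator is c q with c = 1 or c = -1. As c is real, c q is self-adjoint, and the
    transfer relation with its adjoint gives commutation with both projectors. *)
Lemma string_transfer A B p : p \in transferable A B ->
  [/\ pauli_on A (pauli R p), pauli R p *m P_in M = P_in M *m pauli R p &
     exists Ot : 'M[C]_(2 ^ L), [/\ pauli_on B Ot, Ot *m P_out M = P_out M *m Ot &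
                                 M *m pauli R p = Ot *m M]].
Proof.
rewrite inE => /andP[sp /existsP[q /andP[sq /expectM_stab[c cc eqM]]]].
have MO : M *m pauli R p = (c *: pauli R q) *m M.
  by rewrite -scalemxAl scalemxAr -eqM !mulmxA pauli_sqr mul1mx.
have cJ : conjc c = c.
  have : (c - 1) * (c + 1) == 0 by rewrite -subr_sqr expr2 cc expr1n subrr.
  rewrite mulf_eq0 subr_eq0 addr_eq0 => /orP[/eqP->|/eqP->]; first exact: conjc1.
  by rewrite rmorphN1.
have adjMO : adj M *m (c *: pauli R q) = pauli R p *m adj M.
  have := congr1 (@adj R _) MO; rewrite !adj_mulmx pauli_adj => ->.
  by rewrite adj_scalemx pauli_adj cJ.
split; first by rewrite -[pauli R p]scale1r; apply: pauli_on_pauli => //; rewrite expr1n.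
  by rewrite /P_in mulmxA -adjMO -!mulmxA -MO.
exists (c *: pauli R q); split=> //.
  by apply: pauli_on_pauli => //; rewrite (exprM _ 2 2) [c ^+ 2]expr2 cc expr1n.
by rewrite /P_out mulmxA -MO -!mulmxA adjMO.
Qed.

End Transfer.

(** * Mutual information as the maximal size of a transferable family *)

Theorem theorem1 (R : realType) (L : nat) (gs : seq (gate R L))
  (Hvalid : valid_gates gs)
  (Hnz : dynamics gs != 0)
  (A B : {set 'I_L}) :
  exists n : nat,
    [/\ mutual_info (dynamics gs) A B = n%:R,
        exists O : 'I_n -> 'M[R[i]]_(2 ^ L), transferable_family (dynamics gs) A B O
      & forall (m : nat) (O : 'I_m -> 'M[R[i]]_(2 ^ L)),
          transferable_family (dynamics gs) A B O -> (m <= n)%N].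
Proof.
have flat := dynamics_flat Hvalid; set M := dynamics gs in Hnz flat *.
have clT := @closed_trivial_on _ _ _ Hnz flat A; have clH := @closed_transferable _ _ _ Hnz flat A B.
have sTH := trivial_on_sub M A B; have T0 := trivial_on0 Hnz A.
(* n is the rank of the transferable strings modulo the trivial ones: |H| = 2^n |T|. *)
have [n [p [Hp ind cardH]]] := independent_exists (@pstr_addpp L) clT clH sTH T0.
exists n; split; first exact: mutual_info_card.
  exists (fun i => pauli R (p i)); split; first by move=> i; apply: string_transfer.
  apply: (proj2 (independent_logicals Hnz flat (A := A) (c := fun=> 1) (p := p) _ _ _)) => // i.
  - exact: oner_neq0.
  - by rewrite scale1r.
  - by have := Hp i; rewrite inE => /andP[].
move=> m O [transO indO].
have /fin_all_exists[cp cpP] : forall i, exists cp : R[i] * pstr L,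
    [/\ cp.1 != 0, supported A cp.2 & O i = cp.1 *: pauli R cp.2].
  by move=> i; have [/pauli_onP[c [q cq]] _ _] := transO i; exists (c, q).
have indp : independent_mod (trivial_on M A) (fun i => (cp i).2).
  apply: (proj1 (independent_logicals Hnz flat (c := fun i => (cp i).1) _ _ _) indO) => i.
  - by case: (cpP i).
  - by case: (cpP i).
  - by case: (cpP i).
have Hcp i : (cp i).2 \in transferable M A B.
  have [c0 sp defO] := cpP i; have [_ _ tr] := transO i.
  exact: transfer_string defO sp tr.
(* This gives 2^m |T| <= |H| = 2^n |T|, and T is nonempty since it contains 0. *)
have := independent_card (@pstr_addpp L) clT clH sTH T0 Hcp indp.
rewrite cardH leq_pmul2r ?leq_exp2l //.
by apply/card_gt0P; exists 0.
Qed.
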